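(* Suppose that $$\inf_{u\in M(\psi)}\mathcal{E}(u) < \frac{1}{2^p}c_p(G)^p.$$ Then there exists $u_*\in M(\psi)$ with $\mathcal{E}(u_* )=\inf_{u\in M(\psi)}\mathcal{E}(u)$. Moreover, $u_*$ is a critical point of $\mathcal{E}$ with obstacle constraint.
   Context: Fix $p\in(1,\infty)$. $G \in C^\infty(\mathbb{R})$ is odd, $\dot G>0$, and $s\mapsto s\dot G(s)$ belongs to $L^1(\mathbb{R})$; $c_p(G) := 2\lim_{s\to\infty}G(s)$. The obstacle $\psi \in C^0([0,1])$ satisfies $\psi(0)<0$, $\psi(1)<0$, and $\psi(x_0)>0$ for some $x_0\in(0,1)$. $M(\psi) := \{ v \in W^{2,p}(0,1)\cap W^{1,p}_0(0,1) : v \ge \psi \text{ on } [0,1]\}$, $\mathcal{E}(u) := \int_0^1 |(G(u'))'|^p\,dx$, $w_u := -p\,\dot G(u')^{p-1}|u''|^{p-2}u''$. A function $u\in M(\psi)$ is a critical point of $\mathcal{E}$ with obstacle constraint if there is a Radon measure $\mu$ supported on $\{u=\psi\}$ with $-\int_0^1 w_u\,\frac{d}{dx}(\dot G(u')\phi')\,dx=\int\phi\,d\mu$ for all $\phi\in W^{2,p}(0,1)\cap W^{1,p}_0(0,1)$. *)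

(* Defs.v *)
From HB Require Import structures.
From mathcomp Require Import all_boot all_order all_algebra.
From mathcomp Require Import all_classical all_reals all_analysis.
Set Implicit Arguments. Unset Strict Implicit. Unset Printing Implicit Defensive.
Import Order.TTheory GRing.Theory Num.Theory.
Import numFieldNormedType.Exports.
Local Open Scope classical_set_scope.
Local Open Scope ring_scope.

Section Defs.
Variable R : realType.
Notation leb := (@lebesgue_measure R).
Let I01 : set R := `[0%R, 1%R].

(* v ∈ W^{2,p}(0,1), represented by its (absolutely continuous) C^1 representative:
   v1 is the (continuous representative of the) derivative and v2 ∈ L^p(0,1) the
   second weak derivative:  v(x) = v(0) + ∫_0^x v1,  v1(x) = v1(0) + ∫_0^x v2. *)
Definition W2p_rep (p : R) (v v1 v2 : R -> R) : Prop :=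
  [/\ measurable_fun I01 v2,
      (\int[leb]_(x in I01) ((`|v2 x| `^ p)%:E) < +oo)%E,
      (forall x : R, x \in `[0%R, 1%R] -> v1 x = v1 0 + Rintegral leb (`[0%R, x] : set R) v2) &
      (forall x : R, x \in `[0%R, 1%R] -> v x = v 0 + Rintegral leb (`[0%R, x] : set R) v1)].

Definition W2p (p : R) (v : R -> R) : Prop := exists v1 v2, W2p_rep p v v1 v2.

Definition W2p_W1p0 (p : R) (v : R -> R) : Prop := W2p p v /\ v 0 = 0 /\ v 1 = 0.

Definition Mpsi (p : R) (psi : R -> R) : set (R -> R) :=
  [set v | W2p_W1p0 p v /\ (forall x : R, x \in `[0%R, 1%R] -> psi x <= v x)].

(* integrand |(G(u'))'|^p = |Ġ(u') u''|^p, for a representative (u', u'') *)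
Definition energy_rep (p : R) (G : R -> R) (v1 v2 : R -> R) : \bar R :=
  (\int[leb]_(x in I01) ((`|(derive1 G) (v1 x) * v2 x| `^ p)%:E))%E.

(* E(u) = ∫_0^1 |(G(u'))'|^p dx  (independent of the a.e.-representative; we take
   the infimum over representatives, which is the common value, +oo if u ∉ W^{2,p}) *)
Definition energy (p : R) (G : R -> R) (u : R -> R) : \bar R :=
  ereal_inf [set energy_rep p G w.1 w.2 | w in [set w : (R -> R) * (R -> R) | W2p_rep p u w.1 w.2]].

Definition inf_energy (p : R) (G : R -> R) (psi : R -> R) : \bar R :=
  ereal_inf [set energy p G u | u in Mpsi p psi].

Definition cpG (G : R -> R) : R := 2 * lim (G x @[x --> +oo]).

Definition w_rep (p : R) (G : R -> R) (v1 v2 : R -> R) (x : R) : R :=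
  - p * ((derive1 G) (v1 x)) `^ (p - 1) * (`|v2 x| `^ (p - 2)) * v2 x.

(* d/dx (Ġ(u') φ') = G̈(u') u'' φ' + Ġ(u') φ'' *)
Definition test_deriv (G : R -> R) (v1 v2 phi1 phi2 : R -> R) (x : R) : R :=
  (derive1 (derive1 G)) (v1 x) * v2 x * phi1 x + (derive1 G) (v1 x) * phi2 x.

(* u is a critical point of E with obstacle constraint: there is a (finite,
   nonnegative Borel = Radon on [0,1]) measure μ supported on {u = ψ} with
   -∫ w_u (Ġ(u')φ')' dx = ∫ φ dμ for all φ ∈ W^{2,p} ∩ W^{1,p}_0. *)
Definition obstacle_critical (p : R) (G psi u : R -> R) : Prop :=
  exists v1 v2, W2p_rep p u v1 v2 /\
  exists mu : {measure set R -> \bar R},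
    (mu setT < +oo)%E /\
    mu (~` [set x : R | x \in `[0%R, 1%R] /\ u x = psi x]) = 0%E /\
    forall phi phi1 phi2, W2p_rep p phi phi1 phi2 -> phi 0 = 0 -> phi 1 = 0 ->
      (- \int[leb]_(x in I01)
            ((w_rep p G v1 v2 x * test_deriv G v1 v2 phi1 phi2 x)%:E))%E
      = (\int[mu]_(x in I01) (phi x)%:E)%E.

End Defs.

(* Main.v *)
(* The energy of [u] is the L^p norm (to the power p) of [v'], where [v = G(u')].
   Since [u(0) = u(1) = 0], [u'] vanishes somewhere, hence so does [v], and
   [|v| <= E(u)^(1/p)]. Below the threshold this keeps [v] inside a compact part
   of the range of [G], so that [G] can be inverted with a Lipschitz bound. A
   minimising sequence [v_n] is equicontinuous and has a uniform limit; uniform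
   convexity of [|.|^p] makes the derivatives of near-minimisers converge in L^1,
   and Fatou's lemma gives a minimiser [u].

   Differentiating the energy at [u], by convexity of [|.|^p] and dominated
   convergence, shows that the first variation is nonnegative on test functions
   which are positive on the coincidence set [A = {u = psi}], hence on those
   nonnegative on [A]. As [A] stays away from 0 and 1, this functional depends
   only on the values on [A], and its distribution function defines the
   Lebesgue-Stieltjes measure that represents it. *)

Require Import Defs.
From HB Require Import structures.
From mathcomp Require Import all_boot all_order all_algebra.
From mathcomp Require Import all_classical all_reals all_analysis.
From mathcomp Require Import measurable_realfun ring lra.
Set Implicit Arguments. Unset Strict Implicit. Unset Printing Implicit Defensive.
Import Order.TTheory GRing.Theory Num.Theory.
Import numFieldNormedType.Exports.
Local Open Scope classical_set_scope.
Local Open Scope ring_scope.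

(** * Primitives on the unit interval *)

(** The obstacle to the direct method is coercivity: [G] is bounded, so a bound on the energy does
    not by itself bound [u']. Since [c_p(G) / 2] is the supremum [L] of [G], the hypothesis says
    that the infimum lies below [L^p]. The sharp inequality between the L^1 and L^p norms of [v'] on
    an interval of length one turns this into [|v| <= l] with [l < L]. In the variable [v] the
    energy is convex, but the constraint [u >= psi] is not. The convexity argument therefore drops
    the constraint: midpoints are only asked to stay uniformly close to the limit of the [v_n]. The
    constraint is recovered afterwards from the uniform convergence of [u_n]. For the measure, the
    functional is defined only on W^{2,p} functions vanishing at both ends, so neither the constant
    [1] nor indicators are available. On ramps, the functional and the integral are both trapped
    between neighbouring values of one distribution function, and a telescoping sum shows that this
    determines them. *)

Section UnitInterval.
Variable R : realType.
Local Notation leb := (@lebesgue_measure R).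
Local Notation I01 := (`[0%R, 1%R]%classic : set R).
Implicit Types (F f k g v : R -> R) (a b x y s t : R).

Definition L1 g := leb.-integrable I01 (EFin \o g).
Definition itg g a b : R := \int[leb]_(x in `[a, b]%classic) g x.

Lemma mI01 : measurable I01. Proof. by []. Qed.

Lemma L1_sub g a b : L1 g -> 0 <= a -> b <= 1 -> leb.-integrable `[a, b]%classic (EFin \o g).
Proof.
move=> ig a0 b1; apply: integrableS ig => //.
by apply: subset_itv; rewrite bnd_simp.
Qed.

Lemma itgD g a b c : L1 g -> 0 <= a -> a <= b -> b <= c -> c <= 1 ->
  itg g a c = itg g a b + itg g b c.
Proof.
move=> ig a0 ab bc c1.
have := @Rintegral_itvB R g (BLeft a) (BRight c) b.
rewrite !bnd_simp ab bc => /(_ (L1_sub ig a0 c1) isT isT).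
rewrite Rintegral_itv_obnd_cbnd; first by rewrite /itg => <-; rewrite addrC subrK.
apply: integrableS (L1_sub ig a0 c1) => //.
by apply: subset_itvr; rewrite bnd_simp.
Qed.

Lemma itg_ge0 g a b : (forall x, a <= x <= b -> 0 <= g x) -> 0 <= itg g a b.
Proof. by move=> g0; apply: Rintegral_ge0 => x /=; rewrite in_itv/=; exact: g0. Qed.

Lemma ler_itg f g a b : L1 f -> L1 g -> 0 <= a -> b <= 1 ->
  (forall x, a <= x <= b -> f x <= g x) -> itg f a b <= itg g a b.
Proof.
move=> If Ig a0 b1 fg; apply: le_Rintegral => //; exact: L1_sub.
Qed.

Lemma L1_norm g : L1 g -> L1 (fun x => `|g x|).
Proof. by move=> /integrable_norm. Qed.

Lemma L1Z c g : L1 g -> L1 (fun x => c * g x).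
Proof. by move=> /(@integrableZl _ _ _ leb _ mI01 c). Qed.

Lemma L1D f g : L1 f -> L1 g -> L1 (fun x => f x + g x).
Proof. by move=> If Ig; exact: (@integrableD _ _ _ leb _ mI01 _ _ If Ig). Qed.

Lemma L1B f g : L1 f -> L1 g -> L1 (fun x => f x - g x).
Proof. by move=> If Ig; exact: (@integrableB _ _ _ leb _ mI01 _ _ If Ig). Qed.

Lemma L1_meas g : L1 g -> measurable_fun I01 g.
Proof. by move=> /integrableP[/measurable_EFinP]. Qed.

Lemma L1_dom f g : measurable_fun I01 f -> L1 g ->
  (forall x, 0 <= x <= 1 -> `|f x| <= g x) -> L1 f.
Proof.
move=> mf Ig fg; apply: (@le_integrable _ _ _ leb _ _ _ _ _ _ Ig) => //.
  exact/measurable_EFinP.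
move=> x /=; rewrite in_itv/= => /fg h; rewrite lee_fin.
by rewrite (le_trans h)// ler_norm.
Qed.

Lemma L1_cst c : L1 (fun=> c).
Proof.
apply: measurable_bounded_integrable => //; last exact: bounded_cst.
by rewrite /= lebesgue_measure_itv/= lte_fin ltr01 sube0 ltry.
Qed.

Lemma L1_ext f g : (forall x, 0 <= x <= 1 -> f x = g x) -> L1 f -> L1 g.
Proof.
move=> fg; apply: eq_integrable => // x; rewrite inE/= in_itv/= => /fg.
by move=> ->.
Qed.

Lemma itgZ c g a b : L1 g -> 0 <= a -> b <= 1 ->
  itg (fun x => c * g x) a b = c * itg g a b.
Proof. by move=> ig a0 b1; rewrite /itg RintegralZl//; exact: L1_sub. Qed.

Lemma itgDf f g a b : L1 f -> L1 g -> 0 <= a -> b <= 1 ->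
  itg (fun x => f x + g x) a b = itg f a b + itg g a b.
Proof. by move=> If Ig a0 b1; rewrite /itg RintegralD//; exact: L1_sub. Qed.

Lemma itgBf f g a b : L1 f -> L1 g -> 0 <= a -> b <= 1 ->
  itg (fun x => f x - g x) a b = itg f a b - itg g a b.
Proof. by move=> If Ig a0 b1; rewrite /itg RintegralB//; exact: L1_sub. Qed.

Lemma itg_norm g a b : L1 g -> 0 <= a -> b <= 1 ->
  `|itg g a b| <= itg (fun x => `|g x|) a b.
Proof. by move=> ig a0 b1; apply: le_normr_Rintegral => //; exact: L1_sub. Qed.

Lemma itg_cst c a b : a <= b -> itg (fun=> c) a b = c * (b - a).
Proof.
move=> ab; rewrite /itg Rintegral_cst//= lebesgue_measure_itv/= lte_fin.
by case: ltgtP ab => //= ->; rewrite subrr.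
Qed.

Lemma itg_ext f g a b : (forall x, a <= x <= b -> f x = g x) -> itg f a b = itg g a b.
Proof.
by move=> fg; apply: eq_Rintegral => x; rewrite inE/= in_itv/=; exact: fg.
Qed.

Lemma itgxx g a : itg g a a = 0.
Proof. by rewrite /itg set_itv1 Rintegral_set1. Qed.

Lemma itg_fin g : L1 g -> (\int[leb]_(x in I01) (g x)%:E = (itg g 0 1)%:E)%E.
Proof. by move=> ig; rewrite /itg /Rintegral fineK//; exact: integrable_fin_num. Qed.

Lemma ler_itg_sub g a b : L1 g -> (forall x, 0 <= g x) -> 0 <= a -> a <= b -> b <= 1 ->
  itg g a b <= itg g 0 1.
Proof.
move=> ig g0 a0 ab b1.
rewrite (@itgD g 0 a 1)// ?(le_trans ab)// (@itgD g a b 1)//.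
by rewrite addrCA ler_wpDr// addr_ge0// itg_ge0.
Qed.

(** The triangle inequality adds up the bounds along a subdivision of [[0, x]] into [n] equal pieces
    shorter than [d], and the increments of [N] telescope. *)
Lemma chain_bound (D N : R -> R) (d : R) : 0 < d ->
  (forall s t, 0 <= s -> s <= t -> t <= 1 -> t - s < d -> `|D t - D s| <= N t - N s) ->
  forall x, 0 <= x <= 1 -> `|D x - D 0| <= N x - N 0.
Proof.
move=> d0 H x /andP[x0 x1].
pose n := (Num.truncn (x / d)).+1.
have n0 : 0 < n%:R :> R by rewrite ltr0n.
have xn : x / n%:R < d.
  rewrite ltr_pdivrMr// mulrC -ltr_pdivrMr//.
  by have /andP[] := truncn_itv (divr_ge0 x0 (ltW d0)).
suff K i : (i <= n)%N -> `|D (x / n%:R * i%:R) - D 0| <= N (x / n%:R * i%:R) - N 0.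
  by have := K n (leqnn _); rewrite divfK ?gt_eqF.
elim: i => [|i IH] lin; first by rewrite mulr0 !subrr normr0.
have xn0 : 0 <= x / n%:R by rewrite divr_ge0// ltW.
have e : x / n%:R * i.+1%:R = x / n%:R * i%:R + x / n%:R.
  by rewrite -natr1 mulrDr mulr1.
have := H (x / n%:R * i%:R) (x / n%:R * i.+1%:R).
rewrite mulr_ge0// e lerDl xn0 => /(_ isT isT).
have -> : x / n%:R * i%:R + x / n%:R <= 1.
  rewrite -e (le_trans _ x1)// -mulrA ler_piMr// mulrC ler_pdivrMr// mul1r.
  by rewrite ler_nat.
rewrite addrAC subrr add0r xn => /(_ isT isT) h.
have {}IH := IH (ltnW lin).
rewrite -[X in `|X|](subrKA (D (x / n%:R * i%:R))).
rewrite (le_trans (ler_normD _ _))//.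
by rewrite (le_trans (lerD h IH))// subrKA.
Qed.

Lemma heine a b k : {within `[a, b]%classic, continuous k} -> forall e : R, 0 < e ->
  exists2 d : R, 0 < d & forall s t, a <= s <= b -> a <= t <= b -> `|s - t| < d ->
   `|k s - k t| <= e.
Proof.
move=> /subspace_continuousP kc e e0.
(* Near-covering form of compactness, with the radius [d] tending to [0] from the right as
   parameter: a property valid near each point for all small [d] holds for one [d] at all points. *)
have /compact_near_coveringP cpt := @segment_compact R a b.
have := @cpt _ (0^'+) (fun d s => a <= s <= b -> forall t, a <= t <= b -> `|s - t| < d ->
   `|k s - k t| <= e) _.
have -> : `[a, b]%classic = [set s : R | a <= s <= b].
  by apply/seteqP; split=> x /=; rewrite in_itv.
case.
  move=> x x01.
  have /kc : `[a, b]%classic x by rewrite /= in_itv.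
  move=> /cvgrPdist_le/(_ _ (divr_gt0 e0 (ltr0n _ 2))).
  move=> [r /= r0 rP].
  have r20 : 0 < r / 2 by rewrite divr_gt0.
  exists (ball x (r / 2), [set d | d < r / 2]) => /=.
    by split; [exact: nbhsx_ballx|exact: nbhs_right_lt].
  move=> [s d]/= [xs dr] s01 t t01 st.
  have I01E y : a <= y <= b -> `[a, b]%classic y by rewrite /= in_itv.
  have h1 := rP s; have h2 := rP t.
  rewrite /= in h1 h2.
  have xs' : `|x - s| < r / 2 by [].
  have {}h1 := h1 (lt_trans xs' _) (I01E _ s01).
  have {}h2 : `|k x - k t| <= e / 2.
    apply: h2 (I01E _ t01).
    rewrite (splitr r) -(subrKA s) (le_lt_trans (ler_normD _ _))// ltrD//.
    exact: lt_trans dr.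
  have {}h1 : `|k x - k s| <= e / 2 by apply: h1; lra.
  rewrite -(subrKA (k x)) (le_trans (ler_normD _ _))// (splitr e) lerD//.
  by rewrite distrC.
move=> d /= d0 dP; exists (d / 2); first by rewrite divr_gt0.
move=> s t s01 t01 st; apply: (dP (d / 2)) => //=; last by rewrite divr_gt0.
by rewrite sub0r normrN gtr0_norm ?divr_gt0// ltr_pdivrMr// mulr_natr mulr2n ltrDl.
Qed.

Lemma within01 k : (forall e : R, 0 < e ->
  exists2 d : R, 0 < d & forall s t, 0 <= s <= 1 -> 0 <= t <= 1 -> `|s - t| < d ->
   `|k s - k t| <= e) -> {within I01, continuous k}.
Proof.
move=> H; apply/subspace_continuousP => x /=; rewrite in_itv/= => x01.
apply/cvgrPdist_le => e /H[d d0 dP]; exists d => //= y /= xy.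
by rewrite in_itv/= => y01; exact: dP.
Qed.

Lemma cont01_bounded k : {within I01, continuous k} ->
  exists2 M, 0 < M & forall x, 0 <= x <= 1 -> `|k x| <= M.
Proof.
move=> kc.
have kc' : {within I01, continuous (fun x => `|k x|)}.
  by move=> x; apply: cvg_norm; exact: kc.
have [c _ cP] := EVT_max ler01 kc'.
exists (`|k c| + 1); first by rewrite ltr_wpDl.
by move=> x x01; rewrite (le_trans (cP x _))// ?lerDl// in_itv.
Qed.

Lemma cont01_meas k : {within I01, continuous k} -> measurable_fun I01 k.
Proof. by move=> kc; apply: subspace_continuous_measurable_fun. Qed.

Lemma L1M k g : {within I01, continuous k} -> L1 g -> L1 (fun x => k x * g x).
Proof.
move=> kc ig; have [M M0 kM] := cont01_bounded kc.
apply: L1_dom (L1Z M (L1_norm ig)) _.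
  by apply: measurable_funM; [exact: cont01_meas|exact: L1_meas].
by move=> x x01; rewrite normrM ler_wpM2r// kM.
Qed.

Lemma cont01_L1 k : {within I01, continuous k} -> L1 k.
Proof.
by move=> kc; apply: L1_ext (L1M kc (L1_cst 1)) => x _; rewrite mulr1.
Qed.

Lemma norm_eps0 (A C : R) : (forall e : R, 0 < e -> `|A| <= e * C) -> A = 0.
Proof.
move=> H; apply/eqP; rewrite -normr_le0.
have C1 : 0 < `|C| + 1 by rewrite ltr_wpDl.
apply/ler_addgt0Pr => e e0; rewrite add0r.
rewrite (le_trans (H (e / (`|C| + 1)) _)) ?divr_gt0//.
rewrite mulrAC ler_pdivrMr// ler_wpM2l ?ltW//.
by rewrite ltr_pwDr// ler_norm.
Qed.

(* The error [e * itg `|g| s t] is summable over any subdivision: this yields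
   the chain rule, its converse and the fundamental theorem of calculus. *)
Lemma sewing F k g : L1 g -> {within I01, continuous k} ->
  (forall e : R, 0 < e -> exists2 d : R, 0 < d &
    forall s t, 0 <= s -> s <= t -> t <= 1 -> t - s < d ->
      `|F t - F s - k s * itg g s t| <= e * itg (fun x => `|g x|) s t) ->
  forall x, 0 <= x <= 1 -> F x = F 0 + itg (fun x => k x * g x) 0 x.
Proof.
move=> ig kc H x x01.
have ikg := L1M kc ig; have ing := L1_norm ig.
suff : F x - itg (fun x => k x * g x) 0 x - F 0 = 0.
  by move/eqP; rewrite addrAC subr_eq0 subr_eq addrC => /eqP.
apply: (@norm_eps0 _ (2 * itg (fun x => `|g x|) 0 1)) => e e0.
have [d1 d10 H1] := H _ e0; have [d2 d20 H2] := heine kc e0.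
pose D t := F t - itg (fun x => k x * g x) 0 t.
pose N t := e * 2 * itg (fun x => `|g x|) 0 t.
have := @chain_bound D N (Num.min d1 d2) _ _ x x01.
rewrite lt_min d10 d20 => /(_ isT); rewrite /D /N !itgxx mulr0 !subr0.
move=> h; rewrite mulrA (le_trans (h _))//.
- move=> s t s0 st t1; rewrite lt_min => /andP[ts1 ts2].
  rewrite (@itgD _ 0 s t ikg)// (@itgD _ 0 s t ing)//.
  have -> : e * 2 * (itg (fun x0 => `|g x0|) 0 s + itg (fun x0 => `|g x0|) s t) -
    e * 2 * itg (fun x0 => `|g x0|) 0 s =
    e * itg (fun x0 => `|g x0|) s t + e * itg (fun x0 => `|g x0|) s t by ring.
  have -> : F t - (itg (fun x => k x * g x) 0 s + itg (fun x => k x * g x) s t) -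
    (F s - itg (fun x => k x * g x) 0 s) = (F t - F s - k s * itg g s t) +
     (k s * itg g s t - itg (fun x => k x * g x) s t) by ring.
  rewrite (le_trans (ler_normD _ _))// lerD//; first exact: H1.
  rewrite -itgZ// -itgBf//; last exact: L1Z.
  rewrite (le_trans (itg_norm _ _ _))//; first by apply: L1B => //; exact: L1Z.
  rewrite -itgZ//; apply: ler_itg => //.
  + by apply: L1_norm; apply: L1B => //; exact: L1Z.
  + exact: L1Z.
  + move=> y /andP[sy yt]; rewrite -mulrBl normrM ler_wpM2r//.
    have y0 := le_trans s0 sy.
    apply: H2; rewrite ?s0 ?y0 ?(le_trans sy)// ?(le_trans yt)//.
    by rewrite distrC ger0_norm ?subr_ge0// (le_lt_trans _ ts2)// lerD2r.
- case/andP: x01 => x0 x1; rewrite ler_wpM2l ?mulr_ge0// ?(ltW e0)//.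
  exact: ler_itg_sub.
Qed.

(** Absolute continuity on [[0, 1]] with a.e. derivative [g], in integral form. Membership in
    [W^{2,p}] becomes two nested primitives. *)
Definition primitive F g := L1 g /\ forall x, 0 <= x <= 1 -> F x = F 0 + itg g 0 x.

Lemma primitive_sub F g s t : primitive F g -> 0 <= s -> s <= t -> t <= 1 ->
  F t - F s = itg g s t.
Proof.
move=> [ig FE] s0 st t1; rewrite (FE t) ?(le_trans s0)// (FE s); last first.
  by rewrite s0 (le_trans st).
by rewrite (itgD ig _ s0 st)//; ring.
Qed.

Lemma primitive_cont F g : primitive F g -> {within I01, continuous F}.
Proof.
move=> [ig FE].
have c := @parameterized_integral_continuous R 0 1 g ler01 ig.
apply: within01 => e e0; have [d d0 dP] := heine c e0; exists d => // s t s01 t01 st.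
by rewrite (FE s)// (FE t)// opprD addrACA subrr add0r dP.
Qed.

Lemma cont01_comp F (f : R -> R) : {within I01, continuous F} -> continuous f ->
  {within I01, continuous (fun x => f (F x))}.
Proof.
move=> cF cf x.
by apply: (@continuous_comp (subspace I01) R R F f); [exact: cF|exact: cf].
Qed.

(** Common core of two differentiation rules. With [V = F] and [W = h \o F] it is the chain rule;
    with [V = G \o y] and [W = F = y], [f] being the inverse of [G'], it differentiates through the
    inverse of [G]. *)
Lemma primitive_mvt V W F g (f : R -> R) : primitive V g ->
  {within I01, continuous F} -> continuous f ->
  (forall s t, 0 <= s -> s <= t -> t <= 1 -> exists2 y,
     `|y - F s| <= `|F t - F s| & W t - W s = f y * (V t - V s)) ->
  primitive W (fun x => f (F x) * g x).
Proof.
move=> pV cF cf H; have [ig _] := pV.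
have cfF := cont01_comp cF cf.
split; first exact: L1M.
apply: (sewing ig cfF) => e e0.
have [M M0 FM] := cont01_bounded cF.
(* The intermediate point satisfies [|y| <= |F s| + |F t - F s| <= 3 M], whence the interval. *)
have [d1 d10 H1] : exists2 d : R, 0 < d & forall s t, - (M * 3) <= s <= M * 3 ->
    - (M * 3) <= t <= M * 3 -> `|s - t| < d -> `|f s - f t| <= e.
  by apply: heine => //; exact: continuous_subspaceT.
have [d2 d20 H2] := heine cF (divr_gt0 d10 (ltr0n _ 2)).
exists d2 => // s t s0 st t1 ts.
have [y yF ->] := H s t s0 st t1.
have s01 : 0 <= s <= 1 by rewrite s0 (le_trans st).
have t01 : 0 <= t <= 1 by rewrite t1 (le_trans s0).
rewrite (primitive_sub pV)// -mulrBl normrM ler_pM//; last exact: itg_norm.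
have Fst : `|F t - F s| <= d1 / 2.
  by apply: H2 => //; rewrite ger0_norm// subr_ge0.
have := FM _ s01; have := FM _ t01 => Ft Fs.
apply: H1.
- rewrite -ler_norml -(subrK (F s) y) (le_trans (ler_normD _ _))//.
  have := ler_normB (F t) (F s); lra.
- by rewrite -ler_norml; lra.
- by lra.
Qed.

Lemma primitive_comp F g (h : R -> R) : primitive F g ->
  (forall x, derivable h x 1) -> continuous (derive1 h) ->
  primitive (h \o F) (fun x => derive1 h (F x) * g x).
Proof.
move=> pF dh ch; apply: (primitive_mvt pF (primitive_cont pF) ch) => s t s0 st t1.
have ab (a b : R) : a <= b -> exists2 c, c \in `[a, b]%R & h b - h a = derive1 h c * (b - a).
  move=> ab; apply: MVT_segment => //.
    by move=> x _; rewrite derive1E; exact: derivableP.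
  by apply: continuous_subspaceT => x; apply/differentiable_continuous/derivable1_diffP.
have [le|/ltW le] := leP (F s) (F t).
  have [c] := ab _ _ le; rewrite in_itv/= => /andP[sc ct] e; exists c => //.
  by rewrite !ger0_norm ?subr_ge0// lerD2r.
have [c] := ab _ _ le; rewrite in_itv/= => /andP[sc ct] e; exists c.
  by rewrite !ler0_norm ?subr_le0// lerN2 lerD2r.
by rewrite /= -opprB e -mulrN opprB.
Qed.

Lemma primitiveD F g F' g' : primitive F g -> primitive F' g' ->
  primitive (fun x => F x + F' x) (fun x => g x + g' x).
Proof.
move=> [ig FE] [ig' FE']; split; first exact: L1D.
move=> x x01; rewrite FE// FE'// itgDf//; last by case/andP: x01.
by ring.
Qed.

Lemma primitiveZ c F g : primitive F g ->
  primitive (fun x => c * F x) (fun x => c * g x).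
Proof.
move=> [ig FE]; split; first exact: L1Z.
move=> x x01; rewrite FE// itgZ//; last by case/andP: x01.
by ring.
Qed.

End UnitInterval.

(** * Power functions *)

Section PowerFunctions.
Variables (R : realType) (p : R).
Hypothesis p1 : 1 < p.
Implicit Types (a b x t e : R).

Definition np x : R := `|x| `^ p.
(** Up to the factor [p], the derivative of [np]. The factor [x] gives the value [0] at [0] even
    when the exponent [p - 2] is negative. *)
Definition sp x : R := `|x| `^ (p - 2) * x.

Let p0 : 0 < p. Proof. exact: lt_trans p1. Qed.
Let pN0 : p != 0. Proof. by rewrite gt_eqF. Qed.
Let pm1 : 0 < p - 1. Proof. by rewrite subr_gt0. Qed.

Lemma np_ge0 x : 0 <= np x. Proof. exact: powR_ge0. Qed.
Lemma np0 : np 0 = 0. Proof. by rewrite /np normr0 powR0. Qed.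
Lemma np1 : np 1 = 1. Proof. by rewrite /np normr1 powR1. Qed.
Lemma npB x t : np (x - t) = np (t - x). Proof. by rewrite /np distrC. Qed.
Lemma npM x t : np (x * t) = np x * np t. Proof. by rewrite /np normrM powRM. Qed.

Lemma ler_np x t : `|x| <= `|t| -> np x <= np t.
Proof. by move=> xt; apply: ge0_ler_powR; rewrite ?nnegrE ?(ltW p0). Qed.

Lemma np_gt0 x : x != 0 -> 0 < np x.
Proof. by move=> x0; rewrite powR_gt0// normr_gt0. Qed.

Lemma ler_npD x t : np (x + t) <= np 2 * (np x + np t).
Proof.
rewrite mulrDr -!npM; have := ler_normD x t.
have [xt|/ltW tx] := leP `|x| `|t| => h.
  rewrite ler_wpDl ?np_ge0// ler_np// normrM normr_nat.
  by rewrite (le_trans h)// mulr_natl mulr2n lerD2r.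
rewrite ler_wpDr ?np_ge0// ler_np// normrM normr_nat.
by rewrite (le_trans h)// mulr_natl mulr2n lerD2l.
Qed.

(** Beyond [e], one has [|x| = np x / |x|^(p-1)] with [|x|^(p-1) >= e^(p-1)]. Once integrated, this
    bound does the work of Hoelder's inequality, [e] being chosen at each use. *)
Lemma norm_le_np e x : 0 < e -> `|x| <= e + (e `^ (p - 1))^-1 * np x.
Proof.
move=> e0; have c0 : 0 < (e `^ (p - 1))^-1 by rewrite invr_gt0 powR_gt0.
have [xe|/ltW xe] := leP `|x| e.
  by rewrite ler_wpDr// mulr_ge0 ?np_ge0 ?ltW.
rewrite ler_wpDl ?(ltW e0)// /np -(mulr_powRB1 (normr_ge0 x) p0) mulrCA ler_peMr//.
rewrite mulrC ler_pdivlMr ?powR_gt0// mul1r.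
by apply: ge0_ler_powR; rewrite ?nnegrE ?(ltW pm1) ?(ltW e0).
Qed.

Lemma norm_sp x : `|sp x| = `|x| `^ (p - 1).
Proof.
rewrite /sp normrM norm_powR// normr_id.
have [->|x0] := eqVneq x 0; first by rewrite normr0 mulr0 powR0// gt_eqF.
rewrite mulrC -{1}(powRr1 (normr_ge0 x)) -powRD.
  by congr (_ `^ _); ring.
by rewrite normr_eq0 x0 implybT.
Qed.

Lemma sp_mul x : sp x * x = np x.
Proof.
have [->|x0] := eqVneq x 0; first by rewrite mulr0 np0.
rewrite /sp /np -mulrA -expr2 -real_normK ?num_real// -powR_mulrn// -powRD.
  by congr (_ `^ _); ring.
by rewrite normr_eq0 x0 implybT.
Qed.

Lemma sp0 : sp 0 = 0. Proof. by rewrite /sp mulr0. Qed.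
Lemma spM x t : sp (x * t) = sp x * sp t.
Proof. by rewrite /sp normrM powRM// mulrACA. Qed.

Lemma sp_ge0E x : 0 <= x -> sp x = x `^ (p - 1).
Proof.
move=> x0; rewrite -{2}(ger0_norm x0) -norm_sp ger0_norm//.
by rewrite mulr_ge0// powR_ge0.
Qed.

(** Young's inequality for [|a|] and [|b|^(p-1)], with conjugate exponents [p] and [p / (p-1)], is
    the tangent inequality rearranged. *)
Lemma np_tangent a b : np b + p * sp b * (a - b) <= np a.
Proof.
rewrite mulrBr -[p * _ * b]mulrA sp_mul.
suff : p * (sp b * a) <= np a + (p - 1) * np b by lra.
have [q0 qE] : 0 < p / (p - 1) /\ p^-1 + (p / (p - 1))^-1 = 1.
  split; first by rewrite divr_gt0.
  by rewrite invf_div; field; rewrite pN0.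
have := conjugate_powR (normr_ge0 a) (powR_ge0 `|b| (p - 1)) p0 q0 qE.
rewrite -powRrM mulrCA divff ?gt_eqF// mulr1 -norm_sp -/(np a) -/(np b) => h.
rewrite mulrC -ler_pdivlMr//.
rewrite (le_trans (ler_norm _))// normrM mulrC (le_trans h)//.
rewrite mulrDl lerD// invf_div.
by rewrite mulrA (mulrC (np b)).
Qed.

Lemma continuous_np : continuous np.
Proof.
move=> x; have [->|x0] := eqVneq x 0.
  apply/cvgrPdist_le => e e0; rewrite np0.
  exists (e `^ p^-1); first by rewrite /= powR_gt0.
  move=> t /=; rewrite !sub0r !normrN => /ltW te.
  rewrite ger0_norm ?np_ge0//.
  rewrite (_ : e = np (e `^ p^-1)).
    by apply: ler_np; rewrite (ger0_norm (powR_ge0 _ _)).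
  by rewrite /np ger0_norm ?powR_ge0// -powRrM mulVf// powRr1// ltW.
apply: (@continuous_comp _ _ _ (fun x => `|x|) (fun y => y `^ p)).
  exact: norm_continuous.
apply/differentiable_continuous/derivable1_diffP/derivable_powR.
by rewrite in_itv/= andbT normr_gt0.
Qed.

Lemma continuous_sp : continuous sp.
Proof.
move=> x; have [->|x0] := eqVneq x 0.
  apply/cvgrPdist_le => e e0; rewrite sp0.
  exists (e `^ (p - 1)^-1); first by rewrite /= powR_gt0.
  move=> t /=; rewrite !sub0r !normrN norm_sp => /ltW te.
  rewrite (_ : e = (e `^ (p - 1)^-1) `^ (p - 1)).
    by apply: ge0_ler_powR; rewrite ?nnegrE ?powR_ge0 ?(ltW pm1).
  by rewrite -powRrM mulVf ?gt_eqF// powRr1// ltW.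
apply: (@continuousM _ _ (fun x => `|x| `^ (p - 2)) id); last exact: cvg_id.
apply: (@continuous_comp _ _ _ (fun x => `|x|) (fun y => y `^ (p - 2))).
  exact: norm_continuous.
apply/differentiable_continuous/derivable1_diffP/derivable_powR.
by rewrite in_itv/= andbT normr_gt0.
Qed.

Lemma np_midpoint_lt t : -1 <= t -> t < 1 -> np ((t + 1) / 2) < (np t + 1) / 2.
Proof.
move=> t1 tlt1.
have mvt (a b : R) : 0 <= a -> a < b -> exists2 c, a < c < b &
    np b - np a = p * c `^ (p - 1) * (b - a).
  move=> a0 ab.
  have := @MVT R np (fun c => p * c `^ (p - 1)) a b ab.
  case.
  - move=> c; rewrite in_itv/= => /andP[ac cb].
    have c0 : 0 < c := le_lt_trans a0 ac.
    apply: (@near_eq_is_derive _ _ _ (fun x => x `^ p)).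
      by near=> z; rewrite /np gtr0_norm//; near: z; exact: lt_nbhsr.
    exact: is_derive1_powR.
  - by apply: continuous_subspaceT => x; exact: continuous_np.
  by move=> c; rewrite in_itv/= => abc e; exists c.
have [t0|t0] := leP 0 t.
  have m1 : (t + 1) / 2 < 1 by lra.
  have m0 : 0 <= (t + 1) / 2 by lra.
  have tm : t < (t + 1) / 2 by lra.
  have [c /andP[tc cm] ce] := mvt _ _ t0 tm.
  have [d /andP[md d1] de] := mvt _ _ m0 m1.
  have cd : c `^ (p - 1) < d `^ (p - 1).
    apply: gt0_ltr_powR; rewrite ?nnegrE//; lra.
  rewrite np1 in de.
  have : np ((t + 1) / 2) - np t < 1 - np ((t + 1) / 2).
    rewrite ce de (_ : 1 - (t + 1) / 2 = (t + 1) / 2 - t); last by field.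
    by rewrite ltr_pM2r ?subr_gt0// ltr_pM2l.
  lra.
(* For negative [t] the midpoint lies in [[0, 1/2)], where [np] is below [1/2], while the right-hand
   side is at least [1/2]. *)
have h : np ((t + 1) / 2) < 2^-1.
  apply: (@le_lt_trans _ _ (np 2^-1)).
    apply: ler_np; rewrite ger0_norm; last by lra.
    by rewrite ger0_norm; lra.
  have h2 : 2^-1 `^ (p - 1) < 1 `^ (p - 1) :> R.
    by apply: gt0_ltr_powR; rewrite ?nnegrE// invf_lt1// ltr1n.
  rewrite powR1 in h2.
  by rewrite /np ger0_norm// -(mulr_powRB1 _ p0)// gtr_pMr.
have := np_ge0 t; lra.
Unshelve. all: by end_near. Qed.

(* Uniform convexity of [np]: the set where [a / b] is not close to [1] is
   compact after normalisation, and the convexity defect is positive on it. *)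
Lemma np_uniform_convex e : 0 < e -> exists2 C : R, 0 < C & forall a b,
  np (a - b) <= e * (np a + np b) + C * ((np a + np b) / 2 - np ((a + b) / 2)).
Proof.
move=> e0.
(* Within distance [r] of [1] the term in [e] alone suffices, as [np r <= e]; on [[-1, 1 - r]] the
   convexity defect has a positive minimum. *)
pose r : R := Num.min (e `^ p^-1) 1.
have r0 : 0 < r by rewrite /r lt_min powR_gt0//=.
have rp : np r <= e.
  rewrite (_ : e = np (e `^ p^-1)).
    apply: ler_np; rewrite ger0_norm ?(ltW r0)// ger0_norm ?powR_ge0//.
    by rewrite ge_min lexx.
  by rewrite /np ger0_norm ?powR_ge0// -powRrM mulVf// powRr1// ltW.
pose f t := (np t + 1) / 2 - np ((t + 1) / 2).
have f_ge0 t : -1 <= t <= 1 -> 0 <= f t.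
  case/andP=> t1; rewrite le_eqVlt => /predU1P[->|t2].
    by rewrite /f np1 -mulr2n -[1 *+ 2]/(2%:R) divff// np1 subrr.
  by rewrite ltW// subr_gt0 np_midpoint_lt.
have [C C0 CP] : exists2 C : R, 0 < C & forall t, -1 <= t <= 1 - r -> 1 <= C * f t.
  have cf : continuous f.
    move=> t; apply: (@continuousB _ _ _ (fun t => (np t + 1) / 2)
      (fun t => np ((t + 1) / 2))).
      apply: (@continuousM _ _ (fun t => np t + 1)); last exact: cvg_cst.
      by apply: (@continuousD _ _ _ np); [exact: continuous_np|exact: cvg_cst].
    apply: (@continuous_comp _ _ _ (fun t : R => (t + 1) / 2) np).
      apply: (@continuousM _ _ (fun t => t + 1)); last exact: cvg_cst.
      by apply: (@continuousD _ _ _ id); [exact: cvg_id|exact: cvg_cst].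
    exact: continuous_np.
  have r1 : r <= 1 by rewrite ge_min lexx orbT.
  have r2 : -1 <= 1 - r by lra.
  have [c] := EVT_min r2 (continuous_subspaceT cf).
  rewrite in_itv/= => /andP[c1 cr] cP.
  have fc : 0 < f c by rewrite subr_gt0 np_midpoint_lt//; lra.
  exists (f c)^-1; first by rewrite invr_gt0.
  by move=> t tr; rewrite mulrC ler_pdivlMr// mul1r cP// in_itv.
have K t : -1 <= t <= 1 -> np (t - 1) <= e * (np t + 1) + np 2 * C * f t.
  move=> /andP[t1 t2]; have [tr|tr] := leP t (1 - r).
    apply: (@le_trans _ _ (np 2 * C * f t)).
      apply: (@le_trans _ _ (np 2)).
        by apply: ler_np; rewrite ler0_norm ?ger0_norm; lra.
      by rewrite -mulrA ler_peMr ?np_ge0// CP// t1.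
    by rewrite ler_wpDl// mulr_ge0 ?(ltW e0)// addr_ge0 ?np_ge0.
  apply: (@le_trans _ _ e).
    apply: le_trans rp; apply: ler_np.
    by rewrite ler0_norm ?ger0_norm; lra.
  rewrite mulrDr mulr1 addrAC ler_wpDl// addr_ge0// ?mulr_ge0 ?(ltW e0) ?np_ge0//.
    exact: ltW.
  by rewrite f_ge0 ?t1.
have D0 : 0 < np 2 * C by rewrite mulr_gt0 ?np_gt0.
exists (np 2 * C) => //.
(* All terms are homogeneous of degree [p], so dividing by the number of larger modulus reduces to
   [t = a / b] in [[-1, 1]]. *)
have H a b : `|a| <= `|b| -> np (a - b) <= e * (np a + np b) +
    np 2 * C * ((np a + np b) / 2 - np ((a + b) / 2)).
  move=> ab; have [b0|b0] := eqVneq b 0.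
    move: ab; rewrite b0 normr0 normr_le0 => /eqP ->.
    by rewrite subr0 addr0 mul0r np0 addr0 mul0r subr0 !mulr0 addr0.
  have aE : a = b * (a / b) by rewrite mulrCA divff// mulr1.
  have t1 : -1 <= a / b <= 1.
    by rewrite -ler_norml normf_div ler_pdivrMr ?normr_gt0// mul1r.
  have := K _ t1; rewrite -(ler_pM2l (np_gt0 b0)) -npM => h.
  rewrite (_ : a - b = b * (a / b - 1)); last by field.
  rewrite (le_trans h)// le_eqVlt; apply/orP; left; apply/eqP.
  rewrite (_ : np a = np b * np (a / b)); last by rewrite -npM -aE.
  rewrite (_ : np ((a + b) / 2) = np b * np ((a / b + 1) / 2)).
    by rewrite /f; ring.
  by rewrite -npM; congr np; field.
move=> a b; have [ab|/ltW ba] := leP `|a| `|b|; first exact: H.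
by rewrite npB (addrC (np a)) (addrC a); exact: H.
Qed.

End PowerFunctions.

(** * Lower semicontinuity of the energy *)

Section LowerSemicontinuity.
Variable R : realType.
Local Notation leb := (@lebesgue_measure R).
Local Notation I01 := (`[0%R, 1%R]%classic : set R).
Implicit Types (f g : R -> R).

Lemma ae_imp (P Q : R -> Prop) : {ae leb, forall x, P x} ->
  (forall x, P x -> Q x) -> {ae leb, forall x, Q x}.
Proof. by move=> hP PQ; have F := ae_filter_ringOfSetsType leb; exact: filterS hP. Qed.

Lemma invn_le (e : R) : 0 < e -> exists N, forall n, (N <= n)%N -> n.+1%:R^-1 <= e.
Proof.
move=> e0; exists (Num.truncn e^-1) => n Nn; rewrite invf_ple ?posrE//.
by rewrite (le_trans (ltW (truncnS_gt _)))// ler_nat.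
Qed.

Lemma limn_einf_le (u : (\bar R)^nat) (C : R) :
  (forall e : R, 0 < e -> \forall n \near \oo, (u n <= (C + e)%:E)%E) ->
  (limn_einf u <= C%:E)%E.
Proof.
move=> H; apply/lee_addgt0Pr => e e0; rewrite -EFinD limn_einf_lim.
apply: lime_le; first exact: is_cvg_einfs.
have [N _ NP] := H e e0.
apply: nearW => n; apply: (@le_trans _ _ (u (maxn n N))).
  by apply: ereal_inf_lbound => /=; exists (maxn n N) => //=; exact: leq_maxl.
by apply: NP => /=; exact: leq_maxr.
Qed.

Lemma fatou_ae (h : nat -> R -> R) f (C : R) :
  (forall n, measurable_fun I01 (h n)) -> (forall n x, 0 <= h n x) ->
  measurable_fun I01 f -> (forall x, 0 <= f x) ->
  {ae leb, forall x, I01 x -> h ^~ x @ \oo --> f x} ->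
  (forall e : R, 0 < e -> \forall n \near \oo,
     (\int[leb]_(x in I01) (h n x)%:E <= (C + e)%:E)%E) ->
  (\int[leb]_(x in I01) (f x)%:E <= C%:E)%E.
Proof.
move=> mh h0 mf f0 hf hC.
pose u n x := (h n x)%:E.
have mu_ n : measurable_fun I01 (u n) by exact/measurable_EFinP.
have u0 n x : (0 <= u n x)%E by rewrite lee_fin.
apply: (@le_trans _ _ (\int[leb]_(x in I01) limn_einf (u ^~ x))%E).
  apply: ae_ge0_le_integral => //.
  - by move=> x _; rewrite lee_fin.
  - exact/measurable_EFinP.
  - move=> x _; rewrite limn_einf_lim; apply: lime_ge; first exact: is_cvg_einfs.
    by apply: nearW => n; apply: le_ereal_inf_tmp => _ [m /= _ <-].
  - have -> : (fun x => limn_einf (u ^~ x)) = (fun x => - limn_esup (fun n => - u n x))%E.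
      apply/funext => x; rewrite -limn_einfN; congr limn_einf.
      by apply/funext => n; exact/esym/oppeK.
    apply: measurableT_comp => //; apply: measurable_fun_limn_esup => n.
    by apply: measurableT_comp => //; exact: mu_.
  - apply: (ae_imp hf) => x hx Ix.
    have /cvg_limn_einf_sup[-> _] // : u ^~ x @ \oo --> (f x)%:E.
    by apply: cvg_EFin; [exact: nearW|exact: hx].
apply: le_trans (@fatou _ _ R leb I01 (@mI01 R) u mu_ (fun n x _ => u0 n x)) _.
exact: limn_einf_le.
Qed.

(** The sum of the absolute increments has integral at most a geometric series, so it is finite
    a.e.; where it is finite the telescoping series converges absolutely. *)
Lemma ae_cvg_of_summable (h : nat -> R -> R) : (forall n, L1 (h n)) ->
  (forall n, itg (fun x => `|h n.+1 x - h n x|) 0 1 <= 2^-1 ^+ n) ->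
  {ae leb, forall x, I01 x -> cvgn (h ^~ x)}.
Proof.
move=> ih hs.
pose d n x : R := `|h n.+1 x - h n x|.
have d0 n x : (0 <= (d n x)%:E)%E by rewrite lee_fin /d.
have id n : L1 (d n) by apply: L1_norm; exact: L1B.
pose S x : \bar R := (\sum_(n <oo) (d n x)%:E)%E.
have md n : measurable_fun I01 (EFin \o d n) by case/integrableP : (id n).
have iS : leb.-integrable I01 S.
  apply/integrableP; split.
    refine (@ge0_emeasurable_sum _ _ _ _ (fun n x => (d n x)%:E) xpredT _ _).
      by move=> n x _ _; exact: d0.
    by move=> n _; exact: md.
  have -> : (\int[leb]_(x in I01) `|S x| = \int[leb]_(x in I01) S x)%E.
    by apply: eq_integral => x _; rewrite gee0_abs// nneseries_ge0.
  rewrite integral_nneseries//.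
  apply: (@le_lt_trans _ _ (\sum_(n <oo) (2^-1 ^+ n)%:E)%E).
    apply: lee_nneseries => n _; first by rewrite integral_ge0.
    by rewrite (itg_fin (id n)) lee_fin; exact: hs.
  have g : `|2^-1 : R| < 1 by rewrite ger0_norm// invf_lt1// ltr1n.
  rewrite (_ : limn _ = (1 * (1 - 2^-1)^-1)%:E) ?ltry//.
  apply/cvg_lim => //.
  apply: cvg_EFin; first by apply: nearW => n; rewrite sumEFin.
  rewrite (_ : _ \o _ = series (geometric 1 2^-1)); first exact: cvg_geometric_series.
  apply/funext => n /=; rewrite sumEFin /series/=.
  by apply: eq_bigr => i _; rewrite mul1r.
have ae1 : {ae leb, forall x, I01 x -> S x \is a fin_num} by apply: integrable_ae.
apply: (ae_imp ae1) => x Sx Ix.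
have {}Sx := Sx Ix.
have c : cvgn (series (fun n => d n x)).
  apply: nnseries_is_cvg => [i|]; first by rewrite -lee_fin d0.
  by rewrite -ge0_fin_numE// nneseries_ge0.
have := @normed_cvg _ _ (fun n => h n.+1 x - h n x) c.
rewrite (_ : (fun n => h n.+1 x - h n x) = telescope (h ^~ x))//.
rewrite telescopeK => /(is_cvgD (@is_cvg_cst _ (h 0%N x) _ \oo _)).
suff -> : (fun=> h 0%N x) + [sequence h n x - h 0%N x]_n = h ^~ x by [].
by apply/funext => n; exact: subrKC.
Qed.

Definition L1_cauchy (g : nat -> R -> R) := forall e : R, 0 < e -> exists N,
  forall m n, (N <= m)%N -> (N <= n)%N -> itg (fun x => `|g m x - g n x|) 0 1 <= e.

Lemma L1_cauchy_fast_subsequence (g : nat -> R -> R) : L1_cauchy g ->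
  exists s : nat -> nat, [/\ forall i, (i <= s i)%N,
    {homo s : i j / (i <= j)%N} &
    forall i m n, (s i <= m)%N -> (s i <= n)%N ->
      itg (fun x => `|g m x - g n x|) 0 1 <= 2^-1 ^+ i].
Proof.
move=> Cg.
have H i : exists N, forall m n, (N <= m)%N -> (N <= n)%N ->
    itg (fun x => `|g m x - g n x|) 0 1 <= 2^-1 ^+ i by apply: Cg; rewrite exprn_gt0.
have [N NP] := choice H.
(* Summing successors makes [s] increasing and at least as large as both [i] and [N i]. *)
pose s i := (\sum_(j < i.+1) (N j).+1)%N.
have sS i : (s i.+1 = s i + (N i.+1).+1)%N by rewrite /s big_ord_recr.
have Ns i : (N i <= s i)%N.
  by rewrite /s big_ord_recr/= addnS leqW// leq_addl.
exists s; split.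
- elim=> // i IH; rewrite sS -addn1 leq_add//.
- move=> i j /subnK <-; elim: (j - i)%N => // k IH.
  by rewrite addSn sS (leq_trans IH)// leq_addr.
- move=> i m n im jn.
  by apply: NP; [exact: leq_trans im|exact: leq_trans jn].
Qed.

(** The Riesz-Fischer theorem. The subsequence is part of the conclusion because Fatou's lemma uses
    its a.e. convergence, while the rate [2^-i] lets integrals pass to the limit. *)
Lemma L1_complete (g : nat -> R -> R) : (forall n, L1 (g n)) -> L1_cauchy g ->
  exists (f : R -> R) (s : nat -> nat), [/\ L1 f, forall i, (i <= s i)%N,
    {ae leb, forall x, I01 x -> (fun i => g (s i) x) @ \oo --> f x} &
    forall i, itg (fun x => `|g (s i) x - f x|) 0 1 <= 2^-1 ^+ i].
Proof.
move=> ig Cg; have [s [si sS sP]] := L1_cauchy_fast_subsequence Cg.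
pose h i := g (s i).
have ih n : L1 (h n) by exact: ig.
have mh n : measurable_fun I01 (h n) by exact: L1_meas.
have hc := @ae_cvg_of_summable h (fun i => ig (s i)) (fun i =>
  sP i _ _ (sS _ _ (leqnSn i)) (leqnn _)).
(* The upper limit is defined and measurable everywhere, and it is the limit wherever the sequence
   converges. *)
pose f x := fine (limn_esup (fun i => (h i x)%:E)).
have hf : {ae leb, forall x, I01 x -> h ^~ x @ \oo --> f x}.
  apply: (ae_imp hc) => x hx Ix; have /cvg_ex[l hl] := hx Ix.
  have /cvg_limn_einf_sup[_ e] : (fun i => (h i x)%:E) @ \oo --> l%:E.
    by apply: cvg_EFin; [exact: nearW|exact: hl].
  by rewrite /f e.
have mf : measurable_fun I01 f.
  apply: measurableT_comp => //; apply: measurable_fun_limn_esup => n.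
  by apply/measurable_EFinP.
have mhf i : measurable_fun I01 (fun x => `|h i x - f x|).
  by apply: measurableT_comp => //; exact: measurable_funB.
have bd i : (\int[leb]_(x in I01) (`|h i x - f x|)%:E <= (2^-1 ^+ i)%:E)%E.
  apply: (@fatou_ae (fun j x => `|h i x - h j x|)) => //.
  - by move=> n; apply: measurableT_comp => //; exact: measurable_funB.
  - apply: (ae_imp hf) => x hx Ix; apply: cvg_norm; apply: cvgB; first exact: cvg_cst.
    exact: hx.
  - move=> e e0; exists i => // j /= ij; rewrite itg_fin; last first.
      by apply: L1_norm; apply: L1B.
    rewrite lee_fin (@le_trans _ _ (2^-1 ^+ i))//; last by rewrite lerDl ltW.
    exact: sP (leqnn _) (sS _ _ ij).
have ihf i : L1 (fun x => `|h i x - f x|).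
  apply/integrableP; split.
    by apply/measurable_EFinP; exact: mhf.
  under eq_integral do rewrite /= normr_id.
  exact: le_lt_trans (bd i) (ltry _).
exists f, s; split => //; first last.
- by move=> i; rewrite -lee_fin -(itg_fin (ihf i)); exact: bd.
apply: L1_dom mf (L1D (L1_norm (ig (s 0%N))) (ihf 0%N)) _ => x _.
by rewrite -[X in `|X| <= _](subKr (h 0%N x)) ler_normB.
Qed.

Variable p : R.
Hypothesis p1 : 1 < p.

Definition Lp g := measurable_fun I01 g /\ L1 (fun x => np p (g x)).

Lemma np_meas g : measurable_fun I01 g -> measurable_fun I01 (fun x => np p (g x)).
Proof.
move=> mg; apply: (measurableT_comp _ mg).
exact: continuous_measurable_fun (continuous_np p1).
Qed.

Lemma LpP g : Lp g <-> measurable_fun I01 g /\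
  (\int[leb]_(x in I01) ((`|g x| `^ p)%:E) < +oo)%E.
Proof.
split=> -[mg ig]; split => //.
  by rewrite (itg_fin ig) ltry.
apply/integrableP; split; first by apply/measurable_EFinP; exact: np_meas.
by under eq_integral do rewrite /= ger0_norm ?np_ge0//.
Qed.

Lemma Lp_L1 g : Lp g -> L1 g.
Proof.
move=> [mg ig]; apply: L1_dom mg (L1D (L1_cst 1) (L1Z _ ig)) _ => x _.
exact: (norm_le_np p1 _ ltr01).
Qed.

Lemma LpD f g : Lp f -> Lp g -> Lp (fun x => f x + g x).
Proof.
move=> [mf if_] [mg ig].
have mD : measurable_fun I01 (fun x => f x + g x) by exact: measurable_funD.
split => //; apply: L1_dom (np_meas mD) (L1Z (np p 2) (L1D if_ ig)) _ => x _.
by rewrite ger0_norm ?np_ge0// ler_npD.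
Qed.

Lemma LpM (k g : R -> R) : {within I01, continuous k} -> Lp g -> Lp (fun x => k x * g x).
Proof.
move=> ck [mg ig]; split.
  by apply: measurable_funM => //; exact: cont01_meas.
apply: L1_ext (L1M (cont01_comp ck (continuous_np p1)) ig) => x _.
by rewrite npM.
Qed.

Lemma LpZ c g : Lp g -> Lp (fun x => c * g x).
Proof. by apply: LpM; apply: within01 => e e0; exists 1 => // s t *; rewrite subrr normr0 ltW. Qed.

Definition energy_p g := itg (fun x => np p (g x)) 0 1.

Lemma energy_p_ge0 g : 0 <= energy_p g.
Proof. by apply: itg_ge0 => x _; exact: np_ge0. Qed.

Lemma itg_norm_le_energy (e : R) g a b : 0 < e -> Lp g ->
  0 <= a -> a <= b -> b <= 1 ->
  itg (fun x => `|g x|) a b <= e * (b - a) + (e `^ (p - 1))^-1 * energy_p g.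
Proof.
move=> e0 Lg a0 ab b1; have [mg ig] := Lg.
apply: (@le_trans _ _ (itg (fun x => e + (e `^ (p - 1))^-1 * np p (g x)) a b)).
  apply: ler_itg => //; first exact: L1_norm (Lp_L1 Lg).
    by apply: L1D; [exact: L1_cst|exact: L1Z].
  by move=> x _; exact: norm_le_np.
rewrite itgDf//; [|exact: L1_cst|exact: L1Z].
rewrite itg_cst// lerD2l itgZ// ler_wpM2l ?invr_ge0 ?powR_ge0//.
by apply: ler_itg_sub => // x; exact: np_ge0.
Qed.

(** Jensen's inequality, by integrating the tangent line of [np] at [l]. The constant has to be
    sharp, since [l] is later compared with the supremum of [G]. *)
Lemma itg_norm_le_root (l : R) g : 0 < l -> Lp g -> energy_p g <= np p l ->
  itg (fun x => `|g x|) 0 1 <= l.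
Proof.
move=> l0 Lg El; have [mg ig] := Lg.
have sl : 0 < p * sp p l.
  by rewrite mulr_gt0 ?(lt_trans ltr01 p1)// /sp mulr_gt0// powR_gt0// normr_gt0 gt_eqF.
have ing := L1_norm (Lp_L1 Lg).
have : itg (fun x => np p l + p * sp p l * (`|g x| - l)) 0 1 <= energy_p g.
  apply: ler_itg => //.
    by apply: L1D; [exact: L1_cst|apply: L1Z; apply: L1B => //; exact: L1_cst].
  by move=> x _; rewrite (le_trans (np_tangent p1 _ _))// /np normr_id.
rewrite itgDf//; [|exact: L1_cst|by apply: L1Z; apply: L1B => //; exact: L1_cst].
rewrite itgZ//; last by apply: L1B => //; exact: L1_cst.
rewrite itgBf//; last exact: L1_cst.
rewrite !itg_cst// subr0 !mulr1 => h.
have {}h := le_trans h El.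
by move: h; rewrite gerDl pmulr_rle0// subr_le0.
Qed.

Lemma energy_p_fatou (h : nat -> R -> R) f (J : R) : (forall n, Lp (h n)) ->
  measurable_fun I01 f ->
  {ae leb, forall x, I01 x -> h ^~ x @ \oo --> f x} ->
  (forall e : R, 0 < e -> \forall n \near \oo, energy_p (h n) <= J + e) ->
  Lp f /\ energy_p f <= J.
Proof.
move=> Lh mf hf hJ.
have bd : (\int[leb]_(x in I01) (np p (f x))%:E <= J%:E)%E.
  apply: (@fatou_ae (fun n x => np p (h n x))).
  - by move=> n; apply: np_meas; case: (Lh n).
  - by move=> n x; exact: np_ge0.
  - exact: np_meas.
  - by move=> x; exact: np_ge0.
  - apply: (ae_imp hf) => x hx Ix.
    by apply: (cvg_comp _ _ (hx Ix)); exact: continuous_np.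
  - move=> e /hJ; apply: filterS => n hn.
    by rewrite (itg_fin (proj2 (Lh n))) lee_fin.
have Lf : Lp f by apply/LpP; split => //; exact: le_lt_trans bd (ltry _).
by split => //; rewrite -lee_fin -(itg_fin (proj2 Lf)).
Qed.

(** The infimum of this set increases as [e] decreases to [0]; its supremum over [e] is the relaxed
    energy of [v]. No obstacle condition is imposed, so midpoints are allowed. *)
Definition close_energies (v : R -> R) (e : R) : set R :=
  [set E | exists w g, [/\ primitive w g, Lp g,
    forall x, 0 <= x <= 1 -> `|w x - v x| <= e & energy_p g = E]].

(* Near-minimisers of the energy in shrinking uniform neighbourhoods of [v] are
   Cauchy by uniform convexity, since their midpoints lie in the same
   neighbourhood. *)
Lemma energy_p_lsc (v : R -> R) (J : R) :
  (forall e : R, 0 < e -> exists2 E, close_energies v e E & E <= J + e) ->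
  exists g, [/\ primitive v g, Lp g & energy_p g <= J].
Proof.
move=> H.
pose m e := inf (close_energies v e).
have lb0 e : lbound (close_energies v e) 0.
  by move=> _ [w [g [_ _ _ <-]]]; exact: energy_p_ge0.
have hlb e : has_lbound (close_energies v e) by exists 0.
have ne e : 0 < e -> close_energies v e !=set0 by move=> /H[E ? _]; exists E.
have mono e e' : 0 < e -> e <= e' -> m e' <= m e.
  move=> e0 ee'; apply: lb_le_inf; first exact: ne.
  move=> E [w [g [pw Lg wv gE]]]; apply: ge_inf => //.
  by exists w, g; split => // x /wv /le_trans; apply.
have mJ e : 0 < e -> m e <= J.
  move=> e0; apply/ler_addgt0Pr => e' e'0.
  have e''0 : 0 < Num.min e e' by rewrite lt_min e0.
  have [E SE EJ] := H _ e''0.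
  apply: (@le_trans _ _ (m (Num.min e e'))); first by apply: mono; rewrite // ge_min lexx.
  apply: (@le_trans _ _ E); first by apply: ge_inf.
  by rewrite (le_trans EJ)// lerD2l ge_min lexx orbT.
pose S := [set m e | e in [set e | 0 < e]].
have hS : has_sup S.
  split; first by exists (m 1), 1 => //=; exact: ltr01.
  by exists J => _ [e /= e0 <-]; exact: mJ.
pose M := sup S.
have MJ : M <= J by apply: ge_sup; [case: hS|move=> _ [e /= e0 <-]; exact: mJ].
have mM e : 0 < e -> m e <= M by move=> e0; apply: ub_le_sup; [case: hS|exists e].
have M0 : 0 <= M.
  by apply: le_trans (mM 1 ltr01); apply: lb_le_inf => //; exact: ne.
have /choice[w /choice[g wgP]] n : exists w, exists g, [/\ primitive w g, Lp g,
    forall x, 0 <= x <= 1 -> `|w x - v x| <= n.+1%:R^-1 &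
    energy_p g <= M + n.+1%:R^-1].
  have n0 : 0 < n.+1%:R^-1 :> R by rewrite invr_gt0.
  have := @inf_adherent _ _ _ n0 (conj (ne _ n0) (hlb _)).
  move=> [E [w [g [pw Lg wv <-]]]] /ltW Em; exists w, g; split => //.
  by rewrite (le_trans Em)// lerD2r mM.
have Lg n : Lp (g n) by case: (wgP n).
have Cg : L1_cauchy g.
  move=> e e0.
  have e20 : 0 < e / 2 by rewrite divr_gt0.
  (* The target is [energy_p (g i - g j) <= k], where [C1 * k = e / 2]. Half of [k] is spent on the
     term [r * 2 * (M + 1)], the other half on the convexity defect, at most [C * 2 * d]. *)
  pose C1 := ((e / 2) `^ (p - 1))^-1.
  have C10 : 0 < C1 by rewrite invr_gt0 powR_gt0.
  pose k := e / 2 / C1.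
  have k0 : 0 < k by rewrite !divr_gt0.
  pose r := k / (4 * (M + 1)).
  have M1 : 0 < M + 1 by rewrite ltr_wpDl.
  have r0 : 0 < r by rewrite divr_gt0// mulr_gt0.
  have [C C0 CP] := np_uniform_convex p1 r0.
  pose d := Num.min 1 (k / (4 * C)).
  have d0 : 0 < d by rewrite lt_min ltr01 divr_gt0// mulr_gt0.
  (* Every competitor within [d1] of [v] has energy above [M - d]. This applies to midpoints,
     whereas the two energies are at most [M + d], so the defect is at most [2 * d]. *)
  have [_ [d1 /= d10 <-] Md1] := sup_adherent d0 hS.
  pose t := Num.min d d1.
  have t0 : 0 < t by rewrite lt_min d0.
  have [N NP] := invn_le t0; exists N => i j /NP it /NP jt.
  have [pwi _ wvi Ei] := wgP i; have [pwj _ wvj Ej] := wgP j.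
  pose gm x := 2^-1 * (g i x + g j x).
  have Lgm : Lp gm by apply: LpZ; exact: LpD.
  have Em : M - d < energy_p gm.
    apply: lt_le_trans Md1 _; apply: ge_inf => //.
    exists (fun x => 2^-1 * (w i x + w j x)), gm; split => //.
      by apply: primitiveZ; exact: primitiveD.
    move=> x x01.
    rewrite (_ : _ - _ = 2^-1 * (w i x - v x) + 2^-1 * (w j x - v x)); last by field.
    rewrite (le_trans (ler_normD _ _))// !normrM ger0_norm//.
    have td1 : t <= d1 by rewrite ge_min lexx orbT.
    have h1 := le_trans (wvi x x01) (le_trans it td1).
    have h2 := le_trans (wvj x x01) (le_trans jt td1).
    by move: h1 h2; clear; lra.
  have {}Ei := le_trans Ei (lerD (lexx M) it); have {}Ej := le_trans Ej (lerD (lexx M) jt).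
  have [td d1' dC] : [/\ t <= d, d <= 1 & d <= k / (4 * C)].
    by split; rewrite ge_min lexx ?orbT.
  have Lgij : Lp (fun x => g i x - g j x).
    have := LpD (Lg i) (LpZ (-1) (Lg j)).
    by under eq_fun do rewrite mulN1r.
  have [_ ii] := Lg i; have [_ ij] := Lg j; have [_ im] := Lgm.
  have iij := L1D ii ij.
  have ih := L1Z 2^-1 iij; have idef := L1B ih im.
  have key : energy_p (fun x => g i x - g j x) <= k.
    apply: (@le_trans _ _ (itg (fun x => r * (np p (g i x) + np p (g j x)) +
        C * (2^-1 * (np p (g i x) + np p (g j x)) - np p (gm x))) 0 1)).
      apply: ler_itg => //.
      - by case: Lgij.
      - by apply: L1D; apply: L1Z.
      - move=> x _; rewrite (le_trans (CP _ _))// lerD2l ler_wpM2l ?(ltW C0)//.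
        by rewrite mulrC lerD2l lerN2 /gm mulrC.
    rewrite itgDf//; [|exact: L1Z|exact: L1Z].
    rewrite !itgZ// itgBf// itgZ// itgDf// -!/(energy_p _).
    have h1 : r * (energy_p (g i) + energy_p (g j)) <= r * (2 * (M + 1)).
      by rewrite ler_pM2l//; move: Ei Ej td d1'; move: (energy_p _) (energy_p _) (M) (t) (d); clear => *; lra.
    have h2 : C * (2^-1 * (energy_p (g i) + energy_p (g j)) - energy_p gm) <= C * (2 * d).
      by rewrite ler_pM2l//; move: Ei Ej Em td; move: (energy_p (g i)) (energy_p (g j)) (energy_p _) (M) (t) (d); clear => *; lra.
    have h3 : r * (2 * (M + 1)) = k / 2 by rewrite /r; field; rewrite gt_eqF.
    have h4 : C * (2 * d) <= k / 2.
      rewrite (_ : k / 2 = C * (2 * (k / (4 * C)))); last by field; rewrite gt_eqF.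
      by rewrite ler_pM2l// ler_pM2l.
    by rewrite (le_trans (lerD h1 h2))// h3 [leRHS]splitr lerD2l.
  rewrite (le_trans (@itg_norm_le_energy _ _ 0 1 e20 Lgij _ _ _))// subr0 mulr1 -/C1.
  have : C1 * energy_p (fun x => g i x - g j x) <= C1 * k by rewrite ler_pM2l.
  rewrite (_ : C1 * k = e / 2); first by move: (C1 * _); clear => *; lra.
  by rewrite /k mulrCA divff ?mulr1// gt_eqF.
have [f [s [if_ si fae fs]]] := L1_complete (fun n => Lp_L1 (Lg n)) Cg.
have [Lf fM] : Lp f /\ energy_p f <= M.
  apply: (@energy_p_fatou (fun i => g (s i))) => //; first exact: L1_meas.
  move=> e /invn_le[N NP]; exists N => // n /= Nn.
  have [_ _ _ En] := wgP (s n); rewrite (le_trans En)// lerD2l NP//.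
  exact: leq_trans Nn (si n).
exists f; split => //; last exact: le_trans fM MJ.
split => // x x01.
suff : v x - v 0 - itg f 0 x = 0 by move: (itg _ _ _); clear => *; lra.
(* Three errors: the distance from [w] to [v] at [x], the same at [0], and the L^1 distance of the
   derivatives. *)
apply: (@norm_eps0 _ _ 3) => e /invn_le[N NP].
have [pw _ wv _] := wgP (s N).
have [x0 x1] := andP x01.
have xx := @primitive_sub _ _ _ 0 x pw (lexx _) x0 x1.
have h1 := wv x x01; have h2 : `|w (s N) 0 - v 0| <= (s N).+1%:R^-1.
  by apply: wv; rewrite lexx ler01.
have h3 : (s N).+1%:R^-1 <= e by exact: NP.
have h4 : 2^-1 ^+ N <= e.
  apply: le_trans (NP N (leqnn _)); rewrite exprVn lef_pV2 ?posrE ?exprn_gt0//.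
  by rewrite -natrX ler_nat ltn_expl.
have h5 : `|itg (g (s N)) 0 x - itg f 0 x| <= 2^-1 ^+ N.
  have ig := Lp_L1 (Lg (s N)).
  rewrite -itgBf// (le_trans (itg_norm _ _ _))//; first exact: L1B.
  apply: le_trans (fs N); apply: ler_itg_sub => //.
  by apply: L1_norm; exact: L1B.
rewrite (_ : v x - v 0 - itg f 0 x = - (w (s N) x - v x) + (w (s N) 0 - v 0) +
  (itg (g (s N)) 0 x - itg f 0 x)); last by rewrite -xx; ring.
rewrite (le_trans (ler_normD _ _))// (le_trans (lerD (ler_normD _ _) h5))// normrN.
rewrite (_ : e * 3 = e + e + e); last by ring.
exact: lerD (lerD (le_trans h1 h3) (le_trans h2 h3)) h4.
Qed.

End LowerSemicontinuity.

(** * Equicontinuity and uniform limits *)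

Section UniformLimits.
Variables (R : realType) (p : R).
Hypothesis p1 : 1 < p.

Lemma energy_modulus (J e : R) : 0 < e -> exists2 d : R, 0 < d & forall v g,
  primitive v g -> Lp p g -> energy_p p g <= J ->
  forall s t : R, 0 <= s <= 1 -> 0 <= t <= 1 -> `|s - t| < d -> `|v s - v t| <= e.
Proof.
move=> e0.
have pm1 : 0 < p - 1 by rewrite subr_gt0.
(* With parameter [K] in [itg_norm_le_energy] the energy term is at most [e / 2]; the radius
   [e / 2 / K] then makes the length term at most [e / 2]. *)
pose K := ((`|J| + 1) / (e / 2)) `^ (p - 1)^-1.
have J1 : 0 < `|J| + 1 by rewrite ltr_wpDl.
have K0 : 0 < K by rewrite powR_gt0// divr_gt0// divr_gt0.
have KE : K `^ (p - 1) = (`|J| + 1) / (e / 2).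
  by rewrite -powRrM mulVf ?gt_eqF// powRr1// divr_ge0// ltW// divr_gt0.
exists (e / 2 / K); first by rewrite !divr_gt0.
move=> v g pv Lg EJ s t s01 t01 st.
wlog le_ts : s t s01 t01 st / t <= s.
  move=> H; have [ts|/ltW ts] := leP t s; first exact: H.
  by rewrite distrC; apply: H => //; rewrite distrC.
have [t0 _] := andP t01; have [_ s1] := andP s01.
rewrite (primitive_sub pv)// (le_trans (itg_norm _ _ _))//; first by case: pv.
rewrite (le_trans (@itg_norm_le_energy _ _ p1 K _ _ _ K0 Lg _ _ _))//.
rewrite [leRHS]splitr lerD//.
  by rewrite mulrC -ler_pdivlMr// ltW// -(ger0_norm (_ : 0 <= s - t)) ?subr_ge0.
rewrite KE invf_div mulrC mulrA ler_pdivrMr// mulrC ler_pM2l ?divr_gt0//.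
by rewrite (le_trans EJ)// (le_trans (ler_norm _))// lerDl.
Qed.

Lemma ultra_map (S T : Type) (f : S -> T) (U : set_system S) :
  UltraFilter U -> UltraFilter (fmap f U).
Proof.
move=> UU; split; first exact: fmap_proper_filter.
move=> G PG sUG; apply/seteqP; split=> A GA; last exact: sUG.
have [//|UA] := in_ultra_setVsetC (f @^-1` A) UU.
have GnA : G (~` A) by apply: sUG.
by have [x []] := filter_ex (filterI GA GnA).
Qed.

(* Pointwise limits along an ultrafilter replace the extraction of a diagonal
   subsequence in the Arzela-Ascoli theorem. *)
Lemma uniform_cluster (v g : nat -> R -> R) (J B : R) :
  (forall n, [/\ primitive (v n) (g n), Lp p (g n) & energy_p p (g n) <= J]) ->
  (forall n (x : R), 0 <= x <= 1 -> `|v n x| <= B) ->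
  exists w : R -> R, forall e : R, 0 < e -> forall N, exists2 n, (N <= n)%N &
    forall x, 0 <= x <= 1 -> `|v n x - w x| <= e.
Proof.
move=> vg vB.
have [U [UU Uoo]] := @ultraFilterLemma nat \oo _.
have H (x : R) : exists l : R, 0 <= x <= 1 -> v ^~ x @ U --> l.
  have [x01|nx01] := boolP (0 <= x <= 1); last by exists 0.
  have := @segment_compact R (- B) B; rewrite compact_ultra.
  move=> /(_ (v ^~ x @ U) (ultra_map _ UU)).
  have h : U [set n | v n x \in `[- B, B]].
    by apply: filterE => n /=; rewrite in_itv/= -ler_norml; exact: vB.
  by move=> /(_ h)[l [_ lP]]; exists l.
have [w wP] := choice H.
exists w => e e0 N.
have e30 : 0 < e / 3 by rewrite divr_gt0.
have [d d0 dP] := energy_modulus J e30.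
have dv n s t : 0 <= s <= 1 -> 0 <= t <= 1 -> `|s - t| < d -> `|v n s - v n t| <= e / 3.
  by have [pv Lg Eg] := vg n; exact: (dP _ _ pv Lg Eg).
have near x : 0 <= x <= 1 -> \forall n \near U, `|w x - v n x| <= e / 3.
  by move=> x01; have /cvgrPdist_le := wP x x01; apply.
have dw s t : 0 <= s <= 1 -> 0 <= t <= 1 -> `|s - t| < d -> `|w s - w t| <= e / 3.
  move=> s01 t01 st; apply/ler_addgt0Pr => r r0.
  have r20 : 0 < r / 2 by rewrite divr_gt0.
  have h1 : \forall n \near U, `|w s - v n s| <= r / 2.
    by have /cvgrPdist_le := wP s s01; apply.
  have h2 : \forall n \near U, `|w t - v n t| <= r / 2.
    by have /cvgrPdist_le := wP t t01; apply.
  have [n [n1 n2]] := filter_ex (filterI h1 h2).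
  have n3 := dv n s t s01 t01 st.
  rewrite (_ : w s - w t = (w s - v n s) + (v n s - v n t) - (w t - v n t)); last by ring.
  rewrite (le_trans (ler_normB _ _))// (le_trans (lerD (ler_normD _ _) n2))//.
  by move: n1 n3; move: (`|_|) (`|_|); clear => *; lra.
have [M MP] := invn_le (divr_gt0 d0 (ltr0n _ 2)).
(* A grid of [[0, 1]], both ends included, with mesh below [d]. One [n] is good at its finitely many
   nodes, and equicontinuity carries this to every [x] at the cost of two more errors [e / 3]. *)
pose z (i : 'I_M.+2) : R := i%:R / M.+1%:R.
have z01 i : 0 <= z i <= 1.
  by rewrite /z divr_ge0//= ler_pdivrMr// mul1r ler_nat -ltnS.
have nz : \forall n \near U, forall i : 'I_M.+2, `|w (z i) - v n (z i)| <= e / 3.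
  by apply: filter_forall => i; exact: near.
have nN : \forall n \near U, (N <= n)%N by apply: Uoo; exists N.
have [n [n1 n2]] := filter_ex (filterI nz nN).
exists n => // x x01.
have [i xi] : exists i, `|x - z i| < d.
  have [x0 x1] := andP x01.
  have M0 : 0 < M.+1%:R :> R by rewrite ltr0n.
  have /andP[t1 t2] := truncn_itv (mulr_ge0 x0 (ltW M0)).
  have lt : (Num.truncn (x * M.+1%:R) < M.+2)%N.
    by rewrite ltnS -(@ler_nat R) (le_trans t1)// ler_piMl// ltW.
  exists (Ordinal lt); rewrite /z/= ger0_norm; last first.
    by rewrite subr_ge0 ler_pdivrMr.
  rewrite (@le_lt_trans _ _ M.+1%:R^-1)//.
    rewrite lerBlDr -[X in X + _]mul1r -mulrDl ler_pdivlMr// addrC natr1 ltW//.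
  by rewrite (le_lt_trans (MP M (leqnn _)))// ltr_pdivrMr// mulr_natr mulr2n ltrDl.
rewrite (_ : v n x - w x = (v n x - v n (z i)) - (w (z i) - v n (z i)) - (w x - w (z i))); last by ring.
rewrite (le_trans (ler_normB _ _))// (le_trans (lerD (ler_normB _ _) (dw _ _ x01 (z01 i) xi)))//.
have h1 := dv n x (z i) x01 (z01 i) xi; have h2 := n1 i.
by move: h1 h2; move: (`|_|) (`|_|); clear => *; lra.
Qed.

End UniformLimits.

(** * Existence of a minimiser *)

Section Existence.
Variables (R : realType) (p : R) (G : R -> R).
Hypothesis p1 : 1 < p.
Hypothesis dG : forall x, derivable G x 1.
Hypothesis cG' : continuous (derive1 G).
Hypothesis G'0 : forall x, 0 < derive1 G x.
Hypothesis Godd : forall x, G (- x) = - G x.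
Local Notation I01 := (`[0%R, 1%R]%classic : set R).

Lemma W2p_repP u u1 u2 : W2p_rep p u u1 u2 <->
  [/\ Lp p u2, primitive u1 u2 & primitive u u1].
Proof.
split=> [[m2 i2 e1 e]|[L2 [_ e1] [_ e]]].
  have L2 : Lp p u2 by apply/LpP.
  have p2 : primitive u1 u2 by split; [exact: Lp_L1 L2|move=> x x01; rewrite e1// in_itv].
  split => //; split; first exact: cont01_L1 (primitive_cont p2).
  by move=> x x01; rewrite e// in_itv.
have [m2 i2] := (LpP p1 u2).1 L2.
by split.
Qed.

Lemma continuous_G : continuous G.
Proof. by move=> x; apply/differentiable_continuous/derivable1_diffP. Qed.

Lemma G_mvt (a b : R) : a <= b -> exists2 c, a <= c <= b & G b - G a = derive1 G c * (b - a).
Proof.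
move=> ab; have [||c] := @MVT_segment R G (derive1 G) a b ab.
- by move=> x _; rewrite derive1E; exact: derivableP.
- exact: continuous_subspaceT continuous_G.
- by rewrite in_itv/= => abc e; exists c.
Qed.

Lemma G_incr : {mono G : a b / a <= b}.
Proof.
apply: le_mono => a b ab; rewrite -subr_gt0.
have [c _ ->] := G_mvt (ltW ab).
by rewrite mulr_gt0// subr_gt0.
Qed.

Lemma G_at0 : G 0 = 0.
Proof. by have := Godd 0; rewrite oppr0; lra. Qed.

Lemma G_norm x : `|G x| = G `|x|.
Proof.
have G_ge0 y : 0 <= y -> 0 <= G y by move=> y0; rewrite -G_at0 G_incr.
have [x0|/ltW x0] := leP 0 x; first by rewrite !ger0_norm ?G_ge0.
by rewrite (ler0_norm x0) Godd ler0_norm// -oppr_ge0 -Godd G_ge0 ?oppr_ge0.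
Qed.

Lemma G_inverse_lipschitz (M : R) : 0 <= M -> exists2 m, 0 < m & forall a b,
  `|a| <= M -> `|b| <= M -> `|a - b| <= `|G a - G b| / m.
Proof.
move=> M0.
have MM : - M <= M by lra.
have [c _ cP] := EVT_min MM (continuous_subspaceT cG').
exists (derive1 G c) => // a b aM bM.
wlog ab : a b aM bM / a <= b.
  move=> H; have [ab|/ltW ab] := leP a b; first exact: H.
  by rewrite distrC (distrC (G a)); exact: H.
rewrite ler_pdivlMr// distrC (distrC (G a)).
have [d /andP[ad db] ->] := G_mvt ab.
rewrite normrM mulrC ler_wpM2r// ger0_norm; last exact: ltW.
move: aM bM; rewrite !ler_norml => /andP[a1 _] /andP[_ b2].
by apply: cP; rewrite in_itv/= (le_trans a1)// (le_trans db).
Qed.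

(** A continuous function of mean zero has minimum [<= 0] and maximum [>= 0]. Applied to [u'], this
    is Rolle's theorem. *)
Lemma itg0_zero (f : R -> R) : {within I01, continuous f} -> itg f 0 1 = 0 ->
  exists2 x, 0 <= x <= 1 & f x = 0.
Proof.
move=> cf f0.
have [c c01 cP] := EVT_min ler01 cf; have [d d01 dP] := EVT_max ler01 cf.
have If := cont01_L1 cf.
have c0 : f c <= 0.
  rewrite -f0 -[leLHS](mulr1) -[X in _ * X]subr0 -itg_cst//.
  by apply: ler_itg => //; exact: L1_cst.
have d0 : 0 <= f d.
  rewrite -f0 -[leRHS](mulr1) -[X in _ * X]subr0 -itg_cst//.
  by apply: ler_itg => //; exact: L1_cst.
rewrite !in_itv/= in c01 d01.
have [c0' c1] := andP c01; have [d0' d1] := andP d01.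
have sub a b : 0 <= a -> b <= 1 -> {within `[a, b]%classic, continuous f}.
  by move=> a0 b1; apply: continuous_subspaceW cf; apply: subset_itv; rewrite bnd_simp.
have [cd|/ltW dc] := leP c d.
  have [|x] := IVT cd (sub c d c0' d1) (v := 0).
    by rewrite ge_min le_max c0 d0 orbT.
  rewrite in_itv/= => /andP[cx xd] fx; exists x => //.
  by rewrite (le_trans c0')// (le_trans xd).
have [|x] := IVT dc (sub d c d0' c1) (v := 0).
  by rewrite ge_min le_max c0 d0 orbT.
rewrite in_itv/= => /andP[cx xd] fx; exists x => //.
by rewrite (le_trans d0')// (le_trans xd).
Qed.

Lemma Lp_energy_density u u1 u2 : W2p_rep p u u1 u2 -> Lp p (fun x => derive1 G (u1 x) * u2 x).
Proof.
move=> /W2p_repP[L2 pu1 _].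
exact: (LpM p1 (cont01_comp (primitive_cont pu1) cG') L2).
Qed.

Lemma energy_repE u u1 u2 : W2p_rep p u u1 u2 ->
  energy_rep p G u1 u2 = (energy_p p (fun x => derive1 G (u1 x) * u2 x))%:E.
Proof. by move=> /Lp_energy_density[_ ig]; rewrite /energy_rep itg_fin. Qed.

Lemma energy_slope_bound u u1 u2 (l : R) : W2p_rep p u u1 u2 -> u 0 = 0 -> u 1 = 0 ->
  0 < l -> energy_p p (fun x => derive1 G (u1 x) * u2 x) <= np p l ->
  primitive (G \o u1) (fun x => derive1 G (u1 x) * u2 x) /\
  forall x, 0 <= x <= 1 -> `|G (u1 x)| <= l.
Proof.
move=> rep u0 u10 l0 El; have Lg := Lp_energy_density rep.
have [L2 pu1 pu] := (W2p_repP _ _ _).1 rep.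
have pG := primitive_comp pu1 dG cG'; split => // x x01.
have i0 : itg u1 0 1 = 0 by rewrite -(primitive_sub pu)// u0 u10 subrr.
have [y y01 uy] := itg0_zero (primitive_cont pu1) i0.
have ing := L1_norm (Lp_L1 p1 Lg).
have bd a b : 0 <= a -> a <= b -> b <= 1 ->
    `|(G \o u1) b - (G \o u1) a| <= l.
  move=> a0 ab b1; rewrite (primitive_sub pG)//.
  rewrite (le_trans (itg_norm _ _ _))//; first exact: Lp_L1 Lg.
  apply: le_trans (itg_norm_le_root p1 l0 Lg El).
  exact: ler_itg_sub.
have [x0 x1] := andP x01; have [y0 y1] := andP y01.
have [xy|/ltW yx] := leP x y.
  by have := bd _ _ x0 xy y1; rewrite /= uy G_at0 sub0r normrN.
by have := bd _ _ y0 yx x1; rewrite /= uy G_at0 subr0.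
Qed.

Lemma G_surj (l M v : R) : l <= G M -> `|v| <= l -> exists2 y, `|y| <= M & G y = v.
Proof.
move=> lM vl.
have M0 : 0 <= M by rewrite -G_incr G_at0 (le_trans _ lM)// (le_trans _ vl).
have MM : - M <= M by lra.
have [|y] := IVT MM (continuous_subspaceT continuous_G) (v := v).
  rewrite Godd ge_min le_max; move: vl; rewrite ler_norml => /andP[v1 v2].
  by rewrite (le_trans _ v1) ?lerN2// (le_trans v2 lM) orbT.
by rewrite in_itv/= -ler_norml => yM <-; exists y.
Qed.

Variable psi : R -> R.

Definition admissible u u1 u2 := [/\ W2p_rep p u u1 u2, u 0 = 0, u 1 = 0 &
  forall x, 0 <= x <= 1 -> psi x <= u x].

Lemma minimizer_exists (J l M : R) : 0 < l -> l <= G M -> J < np p l ->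
  (forall e : R, 0 < e -> exists u u1 u2, admissible u u1 u2 /\
     energy_p p (fun x => derive1 G (u1 x) * u2 x) <= J + e) ->
  exists u u1 u2, admissible u u1 u2 /\
     energy_p p (fun x => derive1 G (u1 x) * u2 x) <= J.
Proof.
move=> l0 lM Jl H.
have M0 : 0 <= M by rewrite -G_incr G_at0 (le_trans _ lM)// ltW.
have Jl0 : 0 < np p l - J by rewrite subr_gt0.
(* The second entry of the minimum keeps every energy of the sequence at most [np p l], so the slope
   bound holds from the first term on. *)
have /choice[u /choice[u1 /choice[u2 uP]]] n : exists u u1 u2, admissible u u1 u2 /\
    energy_p p (fun x => derive1 G (u1 x) * u2 x) <= J + Num.min n.+1%:R^-1 (np p l - J).
  by apply: H; rewrite lt_min invr_gt0 ltr0n.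
pose v n := G \o u1 n; pose g n x := derive1 G (u1 n x) * u2 n x.
have El n : energy_p p (g n) <= np p l.
  have [_ h] := uP n; apply: le_trans h _.
  by rewrite addrC -lerBrDr ge_min lexx orbT.
have Lg n : Lp p (g n) by have [[rep _ _ _] _] := uP n; exact: Lp_energy_density rep.
have pvb n : primitive (v n) (g n) /\ forall x, 0 <= x <= 1 -> `|v n x| <= l.
  by have [[rep u0 u10 _] _] := uP n; exact: (energy_slope_bound rep u0 u10 l0 (El n)).
have [w wP] := @uniform_cluster R p p1 v g (np p l) l
  (fun n => And3 (pvb n).1 (Lg n) (El n)) (fun n => (pvb n).2).
have [f [pf Lf fJ]] : exists f, [/\ primitive w f, Lp p f & energy_p p f <= J].
  apply: (energy_p_lsc p1) => e e0; have [N NP] := invn_le e0.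
  have [n Nn nw] := wP e e0 N.
  exists (energy_p p (g n)); first by exists (v n), (g n); split => //; exact: (pvb n).1.
  have [_ h] := uP n; apply: le_trans h _; rewrite lerD2l.
  by rewrite ge_min NP.
have wl x : 0 <= x <= 1 -> `|w x| <= l.
  move=> x01; apply/ler_addgt0Pr => e e0; have [n _ /(_ x x01) nw] := wP e e0 0%N.
  have := (pvb n).2 x x01 => vx.
  rewrite -[w x](subKr (v n x)) (le_trans (ler_normB _ _))// lerD//.
(* [y] is the inverse of [G] applied to the limit [w]; it will be the derivative of the
   minimiser. *)
have /choice[y yP] x : exists y, 0 <= x <= 1 -> `|y| <= M /\ G y = w x.
  have [x01|_] := boolP (0 <= x <= 1); last by exists 0.
  by have [y ? ?] := G_surj lM (wl x x01); exists y.
have [m m0 mP] := G_inverse_lipschitz M0.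
have cy : {within I01, continuous y}.
  apply: within01 => e e0.
  have em : 0 < e * m by rewrite mulr_gt0.
  have [d d0 dP] := heine (primitive_cont pf) em; exists d => // s t s01 t01 st.
  have [ys Gs] := yP s s01; have [yt Gt] := yP t t01.
  by rewrite (le_trans (mP _ _ ys yt))// Gs Gt ler_pdivrMr// dP.
have cV : continuous (fun x => (derive1 G x)^-1).
  by move=> x; apply: cvgV; [rewrite gt_eqF|exact: cG'].
(* With this second derivative the energy density of the limit is exactly [f], so the bound on the
   energy of [f] transfers without loss. *)
pose y2 x := (derive1 G (y x))^-1 * f x.
have py : primitive y y2.
  apply: (primitive_mvt pf cy cV) => s t s0 st t1.
  have [ys Gs] := yP s (introT andP (conj s0 (le_trans st t1))).
  have [yt Gt] := yP t (introT andP (conj (le_trans s0 st) t1)).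
  rewrite -Gs -Gt; have [le|/ltW le] := leP (y s) (y t).
    have [c /andP[sc ct] ->] := G_mvt le; exists c.
      by rewrite !ger0_norm ?subr_ge0// lerD2r.
    by rewrite mulKf// gt_eqF.
  have [c /andP[sc ct] e] := G_mvt le; exists c.
    by rewrite !ler0_norm ?subr_le0// lerN2 lerD2r.
  by rewrite -[G _ - G _]opprB e -mulrN opprB mulKf// gt_eqF.
pose U x := itg y 0 x.
have Iy := cont01_L1 cy.
have pU : primitive U y by split => // x _; rewrite /U itgxx add0r.
have Ly2 : Lp p y2.
  exact: (LpM p1 (cont01_comp cy cV) Lf).
have rep : W2p_rep p U y y2 by apply/W2p_repP.
(* The Lipschitz inverse turns closeness of [v n] to [w] into closeness of [u1 n] to [y], and
   integration gives the claim. One index per [e] suffices, as the boundary value at [1] and the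
   obstacle condition are closed conditions. *)
have close (e : R) : 0 < e -> exists n, forall x, 0 <= x <= 1 -> `|u n x - U x| <= e.
  move=> e0; have em : 0 < e * m by rewrite mulr_gt0.
  have [n _ nw] := wP _ em 0%N; exists n => x x01.
  have [[repn u0 u10 _] _] := uP n.
  have [_ pun1 pun] := (W2p_repP _ _ _).1 repn.
  have [x0 x1] := andP x01.
  have Iu : L1 (u1 n) by case: pun.
  have -> : u n x = itg (u1 n) 0 x by rewrite -(primitive_sub pun)// u0 subr0.
  rewrite -itgBf// (le_trans (itg_norm _ _ _))//; first exact: L1B.
  apply: (@le_trans _ _ (itg (fun=> e) 0 x)); last first.
    by rewrite itg_cst// subr0 ler_piMr// ltW.
  apply: ler_itg => //; [by apply: L1_norm; exact: L1B|exact: L1_cst|].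
  move=> z /andP[z0 zx]; have z01 : 0 <= z <= 1 by rewrite z0 (le_trans zx).
  have [yM yG] := yP z z01.
  have u1M : `|u1 n z| <= M.
    by rewrite -G_incr -G_norm (le_trans ((pvb n).2 z z01)).
  by rewrite (le_trans (mP _ _ u1M yM))// yG ler_pdivrMr// nw.
exists U, y, y2; split; last first.
  rewrite (_ : (fun x => _) = f)//; apply/funext => x.
  by rewrite mulVKf// gt_eqF.
split => //.
- by rewrite /U itgxx.
- apply: (@norm_eps0 _ _ 1) => e e0; rewrite mulr1.
  have [n /(_ 1)] := close e e0; rewrite ler01 lexx => /(_ isT).
  by have [[_ _ -> _] _] := uP n; rewrite sub0r normrN.
- move=> x x01; apply/ler_addgt0Pr => e e0.
  have [n /(_ x x01) h] := close e e0.
  have [[_ _ _ /(_ x x01) psiu] _] := uP n.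
  rewrite (le_trans psiu)// -lerBlDl (le_trans (ler_norm _))//.
Qed.

End Existence.

(** * First variation *)

Section FirstVariation.
Variables (R : realType) (p : R) (G : R -> R).
Hypothesis p1 : 1 < p.
Hypothesis dG : forall x, derivable (derive1 G) x 1.
Hypothesis cG' : continuous (derive1 G).
Hypothesis cG'' : continuous (derive1 (derive1 G)).
Hypothesis G'0 : forall x, 0 < derive1 G x.
Local Notation leb := (@lebesgue_measure R).
Local Notation I01 := (`[0%R, 1%R]%classic : set R).
Local Notation G' := (derive1 G).
Local Notation G'' := (derive1 (derive1 G)).

Lemma L1_dct_ge0 (h : nat -> R -> R) (f g : R -> R) :
  (forall n, measurable_fun I01 (h n)) -> measurable_fun I01 f ->
  (forall x, 0 <= x <= 1 -> h ^~ x @ \oo --> f x) -> L1 g ->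
  (forall n x, 0 <= x <= 1 -> `|h n x| <= g x) ->
  (forall n, 0 <= itg (h n) 0 1) -> 0 <= itg f 0 1.
Proof.
move=> mh mf hf Lg hg h0.
have Lh n : L1 (h n) by apply: L1_dom (mh n) Lg _ => x; exact: hg.
have [i1 _ i2] : [/\ leb.-integrable I01 (EFin \o f),
    [sequence \int[leb]_(x in I01) (`|(h n x)%:E - (f x)%:E|)]_n @ \oo --> 0%E &
    [sequence \int[leb]_(x in I01) (h n x)%:E]_n @ \oo --> (\int[leb]_(x in I01) (f x)%:E)%E]%E.
  apply: (@dominated_convergence _ _ _ leb I01 _ (fun n x => (h n x)%:E) (EFin \o f) (EFin \o g)) => //.
  - by move=> n; case/integrableP : (Lh n).
  - exact/measurable_EFinP.
  - apply: aeW => x; rewrite /= in_itv/= => x01.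
    by apply: cvg_EFin; [exact: nearW|exact: hf].
  - by apply: aeW => x n; rewrite /= in_itv/= => x01; rewrite lee_fin hg.
have Lf : L1 f by [].
rewrite -lee_fin -(itg_fin Lf) -(cvg_lim _ i2)//.
apply: lime_ge; first by apply/cvg_ex; eexists; exact: i2.
by apply: nearW => n; have := itg_fin (Lh n) => /= ->; rewrite lee_fin.
Qed.

Lemma mvt_between (f : R -> R) (a b : R) : (forall x, derivable f x 1) ->
  exists2 c, `|c - a| <= `|b - a| & f b - f a = derive1 f c * (b - a).
Proof.
move=> df; have [ab|/ltW ba] := leP a b.
  have [c /andP[ac cb] e] := G_mvt df ab; exists c => //.
  by rewrite !ger0_norm ?subr_ge0// lerD2r.
have [c /andP[ac cb] e] := G_mvt df ba; exists c.
  by rewrite !ler0_norm ?subr_le0// lerN2 lerD2r.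
by rewrite -[LHS]opprB e -mulrN opprB.
Qed.

Lemma cvg_seq_continuous (f : R -> R) (s : nat -> R) (l : R) : continuous f ->
  s @ \oo --> l -> (fun n => f (s n)) @ \oo --> f l.
Proof. by move=> cf cs; apply: (cvg_comp s f cs); exact: cf. Qed.

Lemma cvg_affine (t : nat -> R) (y z : R) : t @ \oo --> 0 ->
  (fun n => y + t n * z) @ \oo --> y.
Proof.
move=> ct; rewrite -[X in _ --> X](_ : y + 0 * z = y); last by rewrite mul0r addr0.
by apply: cvgD; [exact: cvg_cst|apply: cvgM; [exact: ct|exact: cvg_cst]].
Qed.

Lemma cvg_shift (f : R -> R) (t : nat -> R) (y z : R) : continuous f ->
  t @ \oo --> 0 -> (fun n => f (y + t n * z)) @ \oo --> f y.
Proof. by move=> cf ct; apply: cvg_seq_continuous => //; exact: cvg_affine. Qed.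

Lemma cvg_diff_quotient (f : R -> R) (t : nat -> R) (y z : R) :
  (forall x, derivable f x 1) -> continuous (derive1 f) ->
  (forall n, 0 < t n) -> t @ \oo --> 0 ->
  (fun n => (t n)^-1 * (f (y + t n * z) - f y)) @ \oo --> derive1 f y * z.
Proof.
move=> df cf t0 ct.
have /choice[c cP] n : exists c, `|c - y| <= `|t n * z| /\
    f (y + t n * z) - f y = derive1 f c * (t n * z).
  have [c h1 h2] := mvt_between y (y + t n * z) df.
  by exists c; move: h1 h2; rewrite addrAC subrr add0r.
have -> : (fun n => (t n)^-1 * (f (y + t n * z) - f y)) = (fun n => derive1 f (c n) * z).
  apply/funext => n; have [_ ->] := cP n.
  by rewrite mulrCA mulKf// gt_eqF.
apply: cvgM; last exact: cvg_cst.
suff cy : c @ \oo --> y by exact: (cvg_seq_continuous cf cy).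
apply/cvgrPdist_le => e e0.
have /cvgrPdist_le/(_ _ e0) := @cvg_affine t y z ct; apply: filterS => n.
rewrite opprD addNKr normrN distrC; apply: le_trans.
by have [] := cP n.
Qed.

Definition density (u1 u2 : R -> R) (x : R) : R := G' (u1 x) * u2 x.

(** The formal derivative at [t = 0] of [np p] of the density of [u + t f]. *)
Definition energy_variation (u1 u2 f1 f2 : R -> R) (x : R) : R :=
  p * sp p (density u1 u2 x) * (G'' (u1 x) * u2 x * f1 x + G' (u1 x) * f2 x).

Lemma bounded_on (f : R -> R) (M : R) : continuous f -> exists2 K, 0 < K & forall y,
  `|y| <= M -> `|f y| <= K.
Proof.
move=> cf; have [M0|M0] := leP 0 M; last first.
  by exists 1 => // y yM; have := le_lt_trans yM M0; rewrite ltNge normr_ge0.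
have MM : - M <= M by lra.
have cf' : continuous (fun x => `|f x|) by move=> x; apply: cvg_norm; exact: cf.
have [c _ cP] := EVT_max MM (continuous_subspaceT cf').
exists (`|f c| + 1); first by rewrite ltr_wpDl.
by move=> y yM; rewrite (le_trans (cP y _)) ?lerDl// in_itv/= -ler_norml.
Qed.

Section Fixed.
Variables u1 u2 f1 f2 : R -> R.
Hypothesis cu1 : {within I01, continuous u1}.
Hypothesis cf1 : {within I01, continuous f1}.
Hypothesis Lu2 : Lp p u2.
Hypothesis Lf2 : Lp p f2.

Let at_ (t x : R) : R := density (fun x => u1 x + t * f1 x) (fun x => u2 x + t * f2 x) x.

Let H (x : R) : R := `|u2 x| + `|f2 x|.

(** For [t] in [[0, 1]] the slopes [u1 + t * f1] stay in one compact interval, on which [G'] and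
    [G''] are bounded by [K1] and [K2]. The factor [M2] bounds [f1], which accompanies [G'']. *)
Lemma energy_variation_bounds : exists K, 0 < K /\
  (forall t x, 0 <= t <= 1 -> 0 <= x <= 1 -> `|at_ t x| <= K * H x) /\
  (forall t x, 0 < t <= 1 -> 0 <= x <= 1 -> `|t^-1 * (at_ t x - at_ 0 x)| <= K * H x) /\
  (forall x, 0 <= x <= 1 -> `|G'' (u1 x) * u2 x * f1 x + G' (u1 x) * f2 x| <= K * H x).
Proof.
have [M1 M10 u1M] := cont01_bounded cu1; have [M2 M20 f1M] := cont01_bounded cf1.
have [K1 K10 G'K] := bounded_on (M1 + M2) cG'.
have [K2 K20 G''K] := bounded_on (M1 + M2) cG''.
have utM t x : 0 <= t <= 1 -> 0 <= x <= 1 -> `|u1 x + t * f1 x| <= M1 + M2.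
  move=> /andP[t0 t1] x01; rewrite (le_trans (ler_normD _ _))// lerD ?u1M//.
  by rewrite normrM (ger0_norm t0) (le_trans _ (f1M x x01))// ler_piMl.
have C0 : 0 < K1 + K2 * M2 by rewrite addr_gt0// mulr_gt0.
have H1 x : `|u2 x| <= H x by rewrite lerDl.
have H2 x : `|f2 x| <= H x by rewrite lerDr.
exists (K1 + K2 * M2); split => //; split; [|split].
- move=> t x t01 x01; have [t0 t1] := andP t01.
  rewrite /at_ /density normrM ler_pM//.
    by rewrite (le_trans (G'K _ (utM _ _ t01 x01)))// lerDl mulr_ge0 ?ltW.
  rewrite (le_trans (ler_normD _ _))// lerD2l normrM (ger0_norm t0).
  by rewrite ler_piMl.
- move=> t x /andP[t0 t1] x01.
  have t01 : 0 <= t <= 1 by rewrite ltW.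
  have [c cP ce] := mvt_between (u1 x) (u1 x + t * f1 x) dG.
  have cM : `|c| <= M1 + M2.
    rewrite -[c](subrK (u1 x)) (le_trans (ler_normD _ _))// addrC lerD ?u1M//.
    rewrite (le_trans cP)// addrAC subrr add0r normrM (gtr0_norm t0).
    by rewrite (le_trans _ (f1M x x01))// ler_piMl.
  have -> : t^-1 * (at_ t x - at_ 0 x) = G'' c * f1 x * u2 x + G' (u1 x + t * f1 x) * f2 x.
    rewrite /at_ /density !mul0r !addr0.
    have -> : G' (u1 x + t * f1 x) * (u2 x + t * f2 x) - G' (u1 x) * u2 x =
      (G' (u1 x + t * f1 x) - G' (u1 x)) * u2 x + G' (u1 x + t * f1 x) * (t * f2 x) by ring.
    rewrite ce (_ : u1 x + t * f1 x - u1 x = t * f1 x); last by ring.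
    by field; rewrite gt_eqF.
  rewrite (le_trans (ler_normD _ _))// addrC mulrDl lerD//.
    by rewrite normrM ler_pM// G'K// utM.
  by rewrite !normrM ler_pM// ?mulr_ge0// ler_pM// ?G''K// f1M.
- move=> x x01.
  have uM : `|u1 x| <= M1 + M2 by rewrite (le_trans (u1M x x01))// lerDl ltW.
  rewrite (le_trans (ler_normD _ _))// addrC mulrDl lerD//.
    by rewrite normrM ler_pM// G'K.
  by rewrite mulrAC !normrM ler_pM// ?mulr_ge0// ler_pM// ?G''K// f1M.
Qed.

Let LH (K : R) : L1 (fun x => np p (K * H x)).
Proof.
have h (f : R -> R) : Lp p f -> Lp p (fun x => `|f x|).
  move=> [mf lf]; split; first by apply: measurableT_comp.
  by apply: L1_ext lf => x _; rewrite /np normr_id.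
by have [] := LpZ p1 K (LpD p1 (h _ Lu2) (h _ Lf2)).
Qed.

Let H0 x : 0 <= H x. Proof. by rewrite addr_ge0. Qed.

Let sp_bound (K a b x : R) : 0 < K -> `|a| <= K * H x -> `|b| <= K * H x ->
  `|p * sp p a * b| <= p * np p (K * H x).
Proof.
move=> K0 aH bH; have p0 := lt_trans ltr01 p1.
have KH : 0 <= K * H x by rewrite mulr_ge0// ltW.
rewrite -mulrA normrM (gtr0_norm p0) ler_pM2l// normrM (norm_sp p1).
rewrite -(sp_mul p1) (sp_ge0E p1)// ler_pM ?powR_ge0//.
by apply: ge0_ler_powR; rewrite ?nnegrE// ?subr_ge0 ltW.
Qed.

Let cuf (t : R) : {within I01, continuous (fun x => u1 x + t * f1 x)}.
Proof.
move=> x; apply: cvgD; first exact: cu1.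
by apply: cvgM; [exact: cvg_cst|exact: cf1].
Qed.

Let mu2 : measurable_fun I01 u2. Proof. by case: Lu2. Qed.
Let mf2 : measurable_fun I01 f2. Proof. by case: Lf2. Qed.

Let mat (t : R) : measurable_fun I01 (at_ t).
Proof.
apply: (@measurable_funM _ _ _ _ (fun x => G' (u1 x + t * f1 x))).
  exact: (cont01_meas (cont01_comp (@cuf t) cG')).
by apply: measurable_funD => //; apply: measurable_funM.
Qed.

Let mvar : measurable_fun I01 (energy_variation u1 u2 f1 f2).
Proof.
have mG' := cont01_meas (cont01_comp cu1 cG').
have mG'' := cont01_meas (cont01_comp cu1 cG'').
apply: measurable_funM; last first.
  apply: measurable_funD; apply: measurable_funM => //; last exact: cont01_meas.
  exact: measurable_funM.
apply: measurable_funM => //.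
apply: (measurableT_comp (continuous_measurable_fun (continuous_sp p1))).
exact: measurable_funM.
Qed.

Lemma energy_variation_L1 : L1 (energy_variation u1 u2 f1 f2).
Proof.
have [K [K0 [h1 [h2 h3]]]] := energy_variation_bounds.
apply: (L1_dom mvar (L1Z p (LH K))) => x x01.
apply: sp_bound => //; last exact: h3.
have := h1 0 x; rewrite /at_ /density !mul0r !addr0; apply => //.
by rewrite lexx ler01.
Qed.

(** The tangent inequality at the perturbed point bounds the difference quotient of the energy from
    above by the integral of [h n]. The limit then requires only continuity of [sp] and convergence
    of the quotients of the density, with dominating function [p * np p (K * H x)]. *)
Lemma first_variation (t0 : R) : 0 < t0 -> t0 <= 1 ->
  (forall t, 0 < t -> t <= t0 -> energy_p p (density u1 u2) <=
    energy_p p (density (fun x => u1 x + t * f1 x) (fun x => u2 x + t * f2 x))) ->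
  0 <= itg (energy_variation u1 u2 f1 f2) 0 1.
Proof.
move=> t00 t01 min.
have [K [K0 [h1 [h2 _]]]] := energy_variation_bounds.
have at0 : at_ 0 = density u1 u2.
  by apply/funext => x; rewrite /at_ /density !mul0r !addr0.
pose t n : R := t0 * n.+1%:R^-1.
have tn0 n : 0 < t n by rewrite mulr_gt0// invr_gt0.
have tnt0 n : t n <= t0.
  by rewrite ler_piMr ?(ltW t00)// invf_le1// ler1n.
have tn1 n : 0 < t n <= 1 by rewrite tn0 (le_trans (tnt0 n)).
have tcvg : t @ \oo --> 0.
  rewrite -[X in _ --> X](mulr0 t0); apply: cvgM; first exact: cvg_cst.
  exact: cvg_harmonic.
pose h n x := p * sp p (at_ (t n) x) * ((t n)^-1 * (at_ (t n) x - at_ 0 x)).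
have mh n : measurable_fun I01 (h n).
  apply: measurable_funM.
    apply: measurable_funM => //.
    exact: (measurableT_comp (continuous_measurable_fun (continuous_sp p1))).
  by apply: measurable_funM => //; exact: measurable_funB.
have hH n x : 0 <= x <= 1 -> `|h n x| <= p * np p (K * H x).
  move=> x01; apply: sp_bound => //; last exact: h2.
  by apply: h1 => //; have /andP[/ltW ->] := tn1 n.
apply: (L1_dct_ge0 mh mvar _ (L1Z p (LH K)) hH).
  move=> x x01.
  have cat : (fun n => at_ (t n) x) @ \oo --> density u1 u2 x.
    apply: cvgM; first exact: (@cvg_shift G' t (u1 x) (f1 x) cG' tcvg).
    exact: cvg_affine.
  apply: cvgM.
    apply: cvgM; first exact: cvg_cst.
    exact: (cvg_seq_continuous (continuous_sp p1) cat).
  have -> : (fun n => (t n)^-1 * (at_ (t n) x - at_ 0 x)) =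
      (fun n => ((t n)^-1 * (G' (u1 x + t n * f1 x) - G' (u1 x))) * u2 x +
         G' (u1 x + t n * f1 x) * f2 x).
    apply/funext => n; rewrite at0 /at_ /density.
    by field; rewrite gt_eqF.
  rewrite [X in _ --> X + _]mulrAC.
  apply: cvgD.
    apply: cvgM; last exact: cvg_cst.
    exact: (@cvg_diff_quotient G' t (u1 x) (f1 x) dG cG'' tn0 tcvg).
  apply: cvgM; last exact: cvg_cst.
  exact: (@cvg_shift G' t (u1 x) (f1 x) cG' tcvg).
move=> n.
have Lat s : Lp p (at_ s).
  apply: (LpM p1); first exact: (cont01_comp (@cuf s) cG').
  by apply: (LpD p1) => //; exact: LpZ.
have Lh : L1 (h n).
  by apply: (L1_dom (mh n) (L1Z p (LH K))) => x; exact: hH.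
have [[_ i0] [_ it]] := (Lat 0, Lat (t n)).
have : 0 <= energy_p p (at_ (t n)) - energy_p p (at_ 0).
  by rewrite subr_ge0 at0; apply: min.
rewrite -itgBf// => /le_trans; move/(_ (t n * itg (h n) 0 1)).
rewrite pmulr_rge0//; apply; rewrite -itgZ//.
apply: ler_itg => //; [exact: L1B|exact: L1Z|].
move=> x _; rewrite /h.
have -> : t n * (p * sp p (at_ (t n) x) * ((t n)^-1 * (at_ (t n) x - at_ 0 x))) =
  - (p * sp p (at_ (t n) x) * (at_ 0 x - at_ (t n) x)) by field; rewrite gt_eqF.
have := np_tangent p1 (at_ 0 x) (at_ (t n) x).
by rewrite lerBlDl lerBrDr.
Qed.

End Fixed.

(** [sp] is multiplicative, and positivity of [G'] turns [sp p (G' (u1 x))] into a plain power. *)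
Lemma energy_variationE u1 u2 f1 f2 x :
  energy_variation u1 u2 f1 f2 x = - (w_rep p G u1 u2 x * test_deriv G u1 u2 f1 f2 x).
Proof.
rewrite /energy_variation /density /w_rep /test_deriv spM (sp_ge0E p1); last exact: ltW.
by rewrite /sp; ring.
Qed.

End FirstVariation.

(** * Positive functionals and measures *)

Section RepresentingMeasure.
Variable R : realType.
Local Notation I01 := (`[0%R, 1%R]%classic : set R).
Implicit Types (a b x y : R) (f g : R -> R).

Lemma stieltjes_measure (F : R -> R) (T : R) : {homo F : x y / x <= y} ->
  (forall x, F @ at_right x --> F x) -> (forall x, 0 <= F x <= T) ->
  exists mu : {measure set R -> \bar R}, (mu setT <= T%:E)%E /\
    forall a b : R, a <= b -> mu (`]a, b]%classic : set R) = (F b - F a)%:E.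
Proof.
move=> ndF rcF FT.
pose Fc : cumulative R R := HB.pack F (isCumulative.Build R _ R F ndF rcF).
(* [nu] lives on the copy of [R] whose sigma-algebra is generated by the half-open intervals; [mu]
   is the same set function, repackaged as a measure on [R]. *)
pose nu : {measure set (measurableTypeR R) -> \bar R} := lebesgue_stieltjes_measure Fc.
have sa : semi_sigma_additive (nu : set R -> \bar R).
  exact: (@measure_semi_sigma_additive _ _ _ nu).
pose mu : {measure set R -> \bar R} := HB.pack (nu : set R -> \bar R)
  (isMeasure.Build _ R R (nu : set R -> \bar R) (measure0 nu) (measure_ge0 nu) sa).
have muE (a b : R) : a <= b -> mu (`]a, b]%classic : set R) = (F b - F a)%:E.
  move=> ab; rewrite /mu /= /lebesgue_stieltjes_measure /measure_extension.
  rewrite measurable_mu_extE/=; last exact: is_ocitv.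
  by rewrite wlength_itv_bnd.
exists mu; split => //.
pose I n : set R := `]- (n%:R), n%:R]%classic.
have cv : mu (I n) @[n --> \oo] --> mu (\bigcup_n I n).
  apply: nondecreasing_cvg_mu; rewrite /I//; first exact: bigcup_measurable.
  by move=> *; apply/subsetPset/subset_itv; rewrite leBSide/= ?lerN2 ler_nat.
have e : \bigcup_n I n = setT by rewrite -(bigcup_itvT false false).
rewrite -e -(cvg_lim _ cv)//.
apply: lime_le; first by apply/cvg_ex; eexists; exact: cv.
apply: nearW => n; rewrite muE ?ge0_cp// lee_fin.
have /andP[_ h1] := FT n%:R; have /andP[h2 _] := FT (- n%:R); lra.
Qed.

(** The open complement of [A] is covered by the countably many half-open intervals with rational
    ends that miss [A], each of mass zero. [B] enumerates them, with the empty set at all other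
    codes. *)
Lemma stieltjes_null (mu : {measure set R -> \bar R}) (F : R -> R) (A : set R) :
  (forall a b, a <= b -> mu (`]a, b]%classic : set R) = (F b - F a)%:E) ->
  open (~` A) -> (forall a b, a <= b -> `]a, b] `&` A = set0 -> F a = F b) ->
  mu (~` A) = 0%E.
Proof.
move=> muE oA FA.
pose B (k : nat) : set R := if unpickle k is Some q then
   (if asbool (`](ratr (q : rat * rat).1), (ratr q.2)]%classic `&` A = set0)
    then `](ratr q.1), (ratr q.2)]%classic else set0) else set0.
have mB k : measurable (B k).
  by rewrite /B; case: unpickle => // q; case: asboolP.
have B0 k : mu (B k) = 0%E.
  rewrite /B; case: unpickle => [q|]; last exact: measure0.
  case: asboolP => [e|_]; last exact: measure0.
  have [ab|/ltW ba] := leP (ratr q.1 : R) (ratr q.2).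
    by rewrite muE// (FA _ _ ab e) subrr.
  by rewrite set_itv_ge ?measure0// bnd_simp -leNgt.
have sub : ~` A `<=` \bigcup_k B k.
  move=> x /= Ax; have := oA x Ax => -[e /= e0 eA].
  have xe : x - e < x by rewrite ltrBlDr ltrDl.
  have ex : x < x + e by rewrite ltrDl.
  have [q1] := rat_in_itvoo xe; rewrite in_itv/= => /andP[q11 q12].
  have [q2] := rat_in_itvoo ex; rewrite in_itv/= => /andP[q21 q22].
  exists (pickle (q1, q2)); first exact: I.
  rewrite /B pickleK.
  case: asboolP => [_|[]]; first by rewrite /mkset in_itv/= q12 ltW.
  rewrite -subset0 => y []; rewrite /= in_itv/= => /andP[y1 y2]; apply: eA => /=.
  by rewrite ltr_distl; apply/andP; split; lra.
have mA : measurable (~` A) by exact: open_measurable.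
have := @measure_sigma_subadditive _ _ _ mu _ _ mB mA sub.
rewrite eseries0//.
by rewrite measure_le0 => /eqP.
Qed.

(* [D] is the space of test functions, on which the functional sees only the
   values on [A]; [r x d] is a test function that, on [A], descends from [1] to
   [0] across [x, x + d]. It replaces the hat functions of the usual proof, as
   [D] consists of W^{2,p} functions and need not be a lattice. *)
Variables (A : set R) (d0 : R) (D : set (R -> R)) (r : R -> R -> R -> R).
Hypothesis d00 : 0 < d0.
Hypothesis Ad0 : forall x, A x -> d0 <= x <= 1 - d0.
Hypothesis cA : closed A.
Hypothesis Dlin : forall (c : R) f g, D f -> D g -> D (fun x => c * f x + g x).
Hypothesis Dcont : forall f, D f -> {within I01, continuous f}.
Hypothesis D1 : forall f, D f -> f 1 = 0.
Hypothesis Dr : forall x d : R, 0 <= x -> 0 < d -> x + d <= 1 -> D (r x d).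
Hypothesis r01 : forall x d y : R, 0 <= x -> 0 < d -> x + d <= 1 -> A y -> 0 <= r x d y <= 1.
Hypothesis r1 : forall x d y : R, 0 <= x -> 0 < d -> x + d <= 1 -> A y -> y <= x -> r x d y = 1.
Hypothesis r0 : forall x d y : R, 0 <= x -> 0 < d -> x + d <= 1 -> A y -> x + d <= y -> r x d y = 0.
Hypothesis d01 : 0 <= 1 - d0.

Let A01 x : A x -> 0 <= x <= 1.
Proof. move=> /Ad0 /andP[h1 h2]; rewrite (le_trans (ltW d00) h1) (le_trans h2)//.
by rewrite gerBl ltW. Qed.

Definition positive_linear (T : (R -> R) -> R) :=
  (forall (c : R) f g, D f -> D g -> T (fun x => c * f x + g x) = c * T f + T g) /\
  (forall f, D f -> (forall x, A x -> 0 <= f x) -> 0 <= T f).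

(** Substitute for the constant [1], which is not in [D] because test functions vanish at [1]: it
    equals [1] on [A], and [T h] acts as the total mass. *)
Let h := r (1 - d0) d0.
Let Dh : D h. Proof. by apply: Dr => //; rewrite subrK. Qed.
Let h1 x : A x -> h x = 1.
Proof. by move=> Ax; apply: r1; rewrite ?subrK//; have /andP[] := Ad0 Ax. Qed.

Let D0 : D (fun=> 0).
Proof.
have := Dlin (-1) Dh Dh.
by under eq_fun do rewrite mulN1r addNr.
Qed.

Let DZ (c : R) f : D f -> D (fun x => c * f x).
Proof.
move=> Df; have := Dlin c Df D0.
by under eq_fun do rewrite addr0.
Qed.

Section PositiveLinear.
Variable T : (R -> R) -> R.
Hypothesis Tpl : positive_linear T.

Lemma pl_lin (c : R) f g : D f -> D g -> T (fun x => c * f x + g x) = c * T f + T g.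
Proof. exact: Tpl.1. Qed.

Lemma pl0 : T (fun=> 0) = 0.
Proof.
have := pl_lin (-1) Dh Dh; under eq_fun do rewrite mulN1r addNr.
by move=> ->; rewrite mulN1r addNr.
Qed.

Lemma pl_le f g : D f -> D g -> (forall x, A x -> f x <= g x) -> T f <= T g.
Proof.
move=> Df Dg fg; rewrite -subr_ge0.
have -> : T g - T f = T (fun x => (-1) * f x + g x) by rewrite pl_lin// mulN1r addrC.
by apply: Tpl.2; [exact: Dlin|move=> x /fg; rewrite mulN1r addrC subr_ge0].
Qed.

Lemma pl_sum (c : nat -> R) (f : nat -> R -> R) n : (forall i, (i < n)%N -> D (f i)) ->
  D (fun x => \sum_(i < n) c i * f i x) /\
  T (fun x => \sum_(i < n) c i * f i x) = \sum_(i < n) c i * T (f i).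
Proof.
elim: n => [|n IH] Df.
  have e : (fun x => \sum_(i < 0) c i * f i x) = (fun=> 0).
    by apply/funext => x; rewrite big_ord0.
  by rewrite e pl0 big_ord0.
have [DS TS] := IH (fun i hi => Df i (ltnW hi)).
have Dn : D (f n) by exact: Df.
have e : (fun x => \sum_(i < n.+1) c i * f i x) =
    (fun x => c n * f n x + \sum_(i < n) c i * f i x).
  by apply/funext => x; rewrite big_ord_recr addrC.
by rewrite e; split; [exact: Dlin|rewrite pl_lin// TS big_ord_recr addrC].
Qed.

(** On [A], [f] lies between [g - e * h] and [g + e * h]. *)
Lemma pl_close (e : R) f g : D f -> D g -> (forall x, A x -> `|f x - g x| <= e) ->
  `|T f - T g| <= e * T h.
Proof.
move=> Df Dg fg.
have Dgh (c : R) : D (fun x => c * h x + g x) by exact: Dlin.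
rewrite ler_norml; apply/andP; split.
  have : T (fun x => (- e) * h x + g x) <= T f.
    apply: pl_le => // x Ax; rewrite h1// mulr1.
    by have := fg x Ax; rewrite ler_norml => /andP[]; lra.
  by rewrite pl_lin//; lra.
have : T f <= T (fun x => e * h x + g x).
  apply: pl_le => // x Ax; rewrite h1// mulr1.
  by have := fg x Ax; rewrite ler_norml => /andP[]; lra.
by rewrite pl_lin//; lra.
Qed.

End PositiveLinear.

Let node n (i : nat) : R := i%:R / n.+1%:R.

Let node_step n i : node n i.+1 = node n i + n.+1%:R^-1.
Proof. by rewrite /node -natr1 mulrDl mul1r. Qed.

Let node_ge0 n i : 0 <= node n i. Proof. by rewrite divr_ge0. Qed.

Let node_le1 n i : (i <= n.+1)%N -> node n i <= 1.
Proof. by move=> hi; rewrite ler_pdivrMr// mul1r ler_nat. Qed.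

Let node_last n : node n n.+1 = 1. Proof. by rewrite /node divff. Qed.

Let stepfun n i := r (node n i) n.+1%:R^-1.

Let Dstep n i : (i < n.+1)%N -> D (stepfun n i).
Proof. by move=> hi; apply: Dr; rewrite ?invr_gt0// -node_step node_le1. Qed.

(** Summation by parts. At a point [y] of the cell [j], steps before [j] have descended to [0] and
    steps after [j] still equal [1]; the latter telescope to [f (node n j.+1)] because [f 1 = 0].
    The step [j] and the oscillation of [f] on the cell cost [e] each. *)
Lemma step_approximation f (e : R) : D f -> 0 < e -> exists n,
  (forall i, (i < n.+1)%N -> `|f (node n i) - f (node n i.+1)| <= e) /\
  forall y, A y -> `|f y - \sum_(i < n.+1) (f (node n i) - f (node n i.+1)) * stepfun n i y| <= 2 * e.
Proof.
move=> Df e0.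
have [d dgt0 dP] := heine (Dcont Df) e0.
have [n nP] := invn_le (divr_gt0 dgt0 (ltr0n _ 2)).
have {}nP := nP n (leqnn _).
have n0 : 0 < n.+1%:R^-1 :> R by rewrite invr_gt0.
have nd : n.+1%:R^-1 < d.
  by rewrite (le_lt_trans nP)// ltr_pdivrMr// mulr_natr mulr2n ltrDl.
have node01 i : (i <= n.+1)%N -> 0 <= node n i <= 1.
  by move=> hi; rewrite node_ge0 node_le1.
have ci i : (i < n.+1)%N -> `|f (node n i) - f (node n i.+1)| <= e.
  move=> hi; apply: dP; rewrite ?node01 ?(ltnW hi)//.
  by rewrite node_step distrC addrAC subrr add0r gtr0_norm.
exists n; split => // y Ay.
have /andP[y0 y1] := A01 Ay.
pose j := Num.truncn (y * n.+1%:R).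
have /andP[j1 j2] := truncn_itv (mulr_ge0 y0 (ler0n _ n.+1)).
rewrite -/j in j1 j2.
have ylt1 : y < 1 by have /andP[_] := Ad0 Ay; have := d00; lra.
have jn : (j < n.+1)%N.
  rewrite -(@ltr_nat R) (le_lt_trans j1)// -[ltRHS]mul1r ltr_pM2r//.
have yj : node n j <= y by rewrite ler_pdivrMr.
have yj1 : y <= node n j.+1 by rewrite ler_pdivlMr// ltW.
have nodeS i k : (i <= k)%N -> node n i <= node n k.
  by move=> ik; rewrite ler_pM2r ?invr_gt0// ler_nat.
have xd i : (i < n.+1)%N -> node n i + n.+1%:R^-1 <= 1.
  by move=> hi; rewrite -node_step node_le1.
rewrite -(big_mkord xpredT (fun i => (f (node n i) - f (node n i.+1)) * stepfun n i y)).
rewrite (big_cat_nat (n := j))//=; last exact: ltnW.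
rewrite big1_seq; last first.
  move=> i /=; rewrite mem_index_iota => /andP[_ ij].
  rewrite /stepfun r0 ?mulr0//; first by apply: xd; exact: ltn_trans jn.
  by rewrite -node_step (le_trans _ yj)// nodeS.
rewrite add0r big_ltn//.
have -> : \sum_(j.+1 <= i < n.+1) (f (node n i) - f (node n i.+1)) * stepfun n i y =
    f (node n j.+1).
  transitivity (- \sum_(j.+1 <= i < n.+1) (f (node n i.+1) - f (node n i))).
    rewrite -sumrN; apply: eq_big_nat => i /andP[ji hi].
    rewrite /stepfun r1 ?mulr1 ?opprB//; first exact: xd.
    by rewrite (le_trans yj1)// nodeS.
  by rewrite telescope_sumr// node_last D1// sub0r opprK.
have /andP[s0 s1] : 0 <= stepfun n j y <= 1 by apply: r01 => //; exact: xd.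
rewrite opprD addrCA mulr_natl mulr2n (le_trans (ler_normD _ _))// lerD//.
  rewrite normrN normrM (ger0_norm s0) (le_trans _ (ci j jn))// ler_piMr//.
apply: dP; rewrite ?node01 ?y0//.
rewrite distrC ger0_norm ?subr_ge0// node_step (le_lt_trans _ nd)//.
by rewrite lerBlDr addrC lerD2l.
Qed.

(** On each step function the two functionals differ by at most an increment of [F]. The
    coefficients are at most [e] and the increments telescope to [F 1 - F 0]; each replacement of
    [f] by its step sum costs [2 * e] times the mass. *)
Lemma positive_linear_unique (F : R -> R) (T1 T2 : (R -> R) -> R) :
  positive_linear T1 -> positive_linear T2 ->
  (forall x d : R, 0 <= x -> 0 < d -> x + d <= 1 -> F x <= T1 (r x d) <= F (x + d)) ->
  (forall x d : R, 0 <= x -> 0 < d -> x + d <= 1 -> F x <= T2 (r x d) <= F (x + d)) ->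
  forall f, D f -> T1 f = T2 f.
Proof.
move=> P1 P2 F1 F2 f Df; apply/eqP; rewrite -subr_eq0; apply/eqP.
apply: (@norm_eps0 _ _ (2 * T1 h + 2 * T2 h + (F 1 - F 0))) => e e0.
have [n [ci sf]] := step_approximation Df e0.
pose c i := f (node n i) - f (node n i.+1).
have [Ds T1s] := pl_sum P1 c (@Dstep n).
have [_ T2s] := pl_sum P2 c (@Dstep n).
have a1 := pl_close P1 Df Ds sf; have a2 := pl_close P2 Df Ds sf.
have a3 : `|\sum_(i < n.+1) c i * T1 (stepfun n i) - \sum_(i < n.+1) c i * T2 (stepfun n i)|
    <= e * (F 1 - F 0).
  rewrite -sumrB (le_trans (ler_norm_sum _ _ _))//.
  apply: (@le_trans _ _ (\sum_(i < n.+1) e * (F (node n i.+1) - F (node n i)))).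
    apply: ler_sum => i _; rewrite -mulrBr normrM ler_pM//; first exact: ci.
    have xd : node n i + n.+1%:R^-1 <= 1 by rewrite -node_step node_le1.
    have n0 : 0 < n.+1%:R^-1 :> R by rewrite invr_gt0.
    have := F1 _ _ (node_ge0 n i) n0 xd; have := F2 _ _ (node_ge0 n i) n0 xd.
    rewrite -node_step -/(stepfun n i) => /andP[u1 u2] /andP[v1 v2].
    by rewrite ler_norml; apply/andP; split; lra.
  rewrite -mulr_sumr -(big_mkord xpredT (fun i => F (node n i.+1) - F (node n i))).
  by rewrite telescope_sumr// node_last /node mul0r.
rewrite -T1s -T2s in a3.
set s := (fun x => _) in a1 a2 a3.
rewrite (_ : T1 f - T2 f = (T1 f - T1 s) + (T1 s - T2 s) - (T2 f - T2 s)); last by ring.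
rewrite (le_trans (ler_normB _ _))// (le_trans (lerD (le_trans (ler_normD _ _) (lerD a1 a3)) a2))//.
by rewrite le_eqVlt; apply/orP; left; apply/eqP; ring.
Qed.

Section Distribution.
Variable T : (R -> R) -> R.
Hypothesis Tpl : positive_linear T.

Definition majorants (x : R) : set (R -> R) :=
  [set f | [/\ D f, forall y, A y -> 0 <= f y & forall y, A y -> y <= x -> 1 <= f y]].

(** The upper integral of the indicator of []-oo, x]]; it becomes the mass that the measure gives to
    this half-line. *)
Definition distribution x : R := inf [set T f | f in majorants x].

Local Notation F := distribution.

Let lbS x : has_lbound [set T f | f in majorants x].
Proof. by exists 0 => _ [f [Df f0 _] <-]; exact: Tpl.2. Qed.

Let majh x : majorants x h.
Proof. by split => // y Ay; rewrite h1. Qed.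

Let neS x : [set T f | f in majorants x] !=set0.
Proof. by exists (T h), h. Qed.

Lemma distribution_le x f : majorants x f -> F x <= T f.
Proof. by move=> mf; apply: ge_inf => //; exists f. Qed.

Lemma distribution_nd : {homo F : x y / x <= y}.
Proof.
move=> x y xy; apply: lb_le_inf => // _ [f [Df f0 f1] <-].
by apply: distribution_le; split => // z Az zx; rewrite f1// (le_trans zx).
Qed.

Lemma distribution_bounds x : 0 <= F x <= T h.
Proof.
rewrite distribution_le// andbT; apply: lb_le_inf => // _ [f [Df f0 _] <-].
exact: Tpl.2.
Qed.

Lemma distribution_cst a b : a <= b -> `]a, b]%classic `&` A = set0 -> F a = F b.
Proof.
move=> ab e; congr inf; congr (_ @` _); apply/seteqP; split=> f [Df f0 f1]; split => // y Ay.
  move=> yb; have [ya|ay] := leP y a; first exact: f1.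
  suff : (`]a, b]%classic `&` A) y by rewrite e.
  by split => //; rewrite /= in_itv/= ay.
by move=> ya; apply: f1 => //; exact: le_trans ya ab.
Qed.

Lemma distribution_lt x : x < d0 -> F x = 0.
Proof.
move=> xd; apply/eqP; rewrite eq_le; have /andP[-> _] := distribution_bounds x.
rewrite andbT -(pl0 Tpl); apply: distribution_le; split => // y /Ad0/andP[dy _] yx.
by have := le_lt_trans yx (lt_le_trans xd dy); rewrite ltxx.
Qed.

(** On [A], [r x d] is itself a majorant at [x] and lies below every majorant at [x + d]. *)
Lemma distribution_ramp x d : 0 <= x -> 0 < d -> x + d <= 1 ->
  F x <= T (r x d) <= F (x + d).
Proof.
move=> x0 d0' xd; have Drx := Dr x0 d0' xd; apply/andP; split.
  apply: distribution_le; split => // y Ay; first by have /andP[] := r01 x0 d0' xd Ay.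
  by move=> yx; rewrite r1.
apply: lb_le_inf => // _ [f [Df f0 f1] <-].
apply: pl_le => // y Ay; have /andP[_ ry] := r01 x0 d0' xd Ay.
have [yx|/ltW xy] := leP y (x + d); first by rewrite (le_trans ry)// f1.
by rewrite r0// f0.
Qed.

(** Adding [e' * h] to a nearly optimal majorant at [x] makes it a majorant slightly to the right:
    by continuity of [f] if [x] is in [A], and because [A] has no points near [x] otherwise. *)
Lemma distribution_right_continuous x : F @ at_right x --> F x.
Proof.
apply/cvgrPdist_le => e e0.
(* The total loss is [e' * T h] from the added multiple of [h] plus [e'] from the infimum, that is
   [e]. *)
pose e' := e / (1 + T h).
have Th0 : 0 <= T h by apply: Tpl.2 => // y Ay; rewrite h1.
have T1 : 0 < 1 + T h by rewrite ltr_wpDr.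
have e'0 : 0 < e' by rewrite divr_gt0.
have [_ [f [Df f0 f1] <-] fF] := inf_adherent e'0 (conj (neS x) (lbS x)).
have Dg : D (fun y => e' * h y + f y) by exact: Dlin.
have [d dgt0 dP] : exists2 d : R, 0 < d & forall y, A y -> y < x + d -> 1 <= e' * h y + f y.
  have base y : A y -> y <= x -> 1 <= e' * h y + f y.
    by move=> Ay yx; rewrite h1// mulr1 ler_wpDl ?f1// ltW.
  have [Ax|nAx] := pselect (A x).
    have [d dgt0 dP] := heine (Dcont Df) e'0; exists d => // y Ay yx.
    have [yx'|xy] := leP y x; first exact: base.
    have := dP x y (A01 Ax) (A01 Ay); rewrite distrC gtr0_norm ?subr_gt0//.
    rewrite ltrBlDl => /(_ yx); rewrite ler_norml => /andP[_ h2].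
    have := f1 x Ax (lexx _); rewrite h1// mulr1.
    by move: h2; rewrite lerBlDr => h2 h3; exact: le_trans h3 h2.
  have oA : open (~` A) by exact: closed_openC.
  have [d /= dgt0 dA] := oA x nAx; exists d => // y Ay yx.
  have [yx'|xy] := leP y x; first exact: base.
  suff : (~` A) y by [].
  by apply: dA; rewrite /= distrC gtr0_norm ?subr_gt0// ltrBlDl.
exists d => //= y; rewrite /ball_/= => xy xlty.
rewrite distrC ger0_norm; last by rewrite subr_ge0; apply/distribution_nd/ltW.
have yd : y < x + d by move: xy; rewrite distrC gtr0_norm ?subr_gt0// ltrBlDl.
have : F y <= T (fun z => e' * h z + f z).
  apply: distribution_le; split => // z Az.
    by rewrite h1// addr_ge0 ?f0// mulr1 ltW.
  by move=> zy; apply: dP => //; exact: le_lt_trans yd.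
rewrite (pl_lin Tpl)// => hF.
rewrite lerBlDl (le_trans hF)//.
rewrite (le_trans (lerD (lexx (e' * T h)) (ltW fF)))//.
rewrite addrCA lerD2l -[X in _ + X]mulr1 -mulrDr addrC /e' divfK// gt_eqF//.
Qed.

(** By [positive_linear_unique] it is enough to trap the [mu]-integrals of the ramps between the
    same values of [F]. This follows by comparison, on [A], with indicators of half-lines. *)
Theorem positive_linear_representation : exists mu : {measure set R -> \bar R},
  [/\ (mu setT < +oo)%E, mu (~` A) = 0%E &
   forall f, D f -> (\int[mu]_(x in I01) (f x)%:E = (T f)%:E)%E].
Proof.
have [mu [muT muE]] := stieltjes_measure distribution_nd distribution_right_continuous
  distribution_bounds.
have mu0 : mu (~` A) = 0%E.
  by apply: (stieltjes_null muE (closed_openC cA)); exact: distribution_cst.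
exists mu; split => //; first exact: le_lt_trans muT (ltry _).
have muI : (mu I01 < +oo)%E.
  by apply: le_lt_trans (le_lt_trans muT (ltry _)); apply: le_measure; rewrite ?inE.
have mA : measurable (~` A) by apply: open_measurable; exact: closed_openC.
have bdint f : measurable_fun I01 f -> (exists M, forall x, 0 <= x <= 1 -> `|f x| <= M) ->
    mu.-integrable I01 (EFin \o f).
  move=> mf [M fM]; apply: measurable_bounded_integrable => //.
  exists M; split; first exact: num_real.
  move=> K MK x /=; rewrite in_itv/= => x01.
  by rewrite (le_trans (fM x x01))// ltW.
have Dint f : D f -> mu.-integrable I01 (EFin \o f).
  move=> Df; apply: bdint; first exact: cont01_meas (Dcont Df).
  by have [M _ fM] := cont01_bounded (Dcont Df); exists M.
have pos f : mu.-integrable I01 (EFin \o f) -> (forall x, A x -> 0 <= f x) ->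
    0 <= \int[mu]_(x in I01) f x.
  move=> mf f0; rewrite /Rintegral (negligible_integral mA _ mf mu0)//.
  by apply: Rintegral_ge0 => x [_ /contrapT]; exact: f0.
pose I (f : R -> R) : R := \int[mu]_(x in I01) f x.
have Ipl : positive_linear I.
  split=> [c f g Df Dg|f Df f0]; last exact: pos (Dint f Df) f0.
  rewrite /I RintegralD//; [|exact: Dint (DZ c Df)|exact: Dint].
  by rewrite RintegralZl//; exact: Dint.
have Framp x d : 0 <= x -> 0 < d -> x + d <= 1 -> F x <= I (r x d) <= F (x + d).
  move=> x0 dgt0 xd; have Drx := Dr x0 dgt0 xd.
  pose J (y : R) : R -> R := \1_(`]-oo, y]%classic : set R).
  have JE y z : J y z = (z <= y)%R%:R by rewrite /J indicE mem_setE in_itv.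
  have iJ y : mu.-integrable I01 (EFin \o J y).
    apply: bdint; first exact: measurable_indic.
    by exists 1 => z _; rewrite JE; case: (z <= y); rewrite ?normr1 ?normr0 ?ler01.
  have IJ y : 0 <= y -> y <= 1 -> \int[mu]_(z in I01) J y z = F y.
    move=> y0 y1; rewrite /Rintegral /J integral_indic//.
    have -> : `]-oo, y]%classic `&` I01 = `[0, y]%classic :> set R.
      apply/seteqP; split=> z /=; rewrite !in_itv/=.
        by move=> [zy /andP[z0 _]]; rewrite z0.
      by move=> /andP[z0 zy]; rewrite zy z0 (le_trans zy).
    (* The base point [-1] lies to the left of [0], so []-1, y]] contains [[0, y]], and the part
       between them misses [A] and has no mass. *)
    have F0 : F (-1) = 0 by apply: distribution_lt; rewrite (lt_trans _ d00)// ltrN10.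
    have muy : mu (`]-1, y]%classic : set R) = (F y)%:E.
      by rewrite muE ?F0 ?subr0// (le_trans _ y0)// lerN10.
    have -> : mu (`[0, y]%classic : set R) = (F y)%:E; last by [].
    apply/eqP; rewrite eq_le -muy; apply/andP; split.
      apply: le_measure; rewrite ?inE//.
      by apply: subset_itv; rewrite bnd_simp// ltrN10.
    rewrite -[leRHS]adde0 -mu0.
    apply: (@le_trans _ _ (mu (`[0, y]%classic `|` ~` A))).
      apply: le_measure; rewrite ?inE//; first exact: measurableU.
      move=> z /=; rewrite !in_itv/= => /andP[_ zy].
      have [Az|nAz] := pselect (A z); last by right.
      by left; have /andP[-> _] := A01 Az.
    exact: measureU2.
  have IB f g : mu.-integrable I01 (EFin \o f) -> mu.-integrable I01 (EFin \o g) ->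
      (forall y, A y -> f y <= g y) ->
      \int[mu]_(y in I01) f y <= \int[mu]_(y in I01) g y.
    move=> jf jg fg; rewrite -subr_ge0 -RintegralB//.
    apply: pos => [|y /fg]; last by rewrite subr_ge0.
    exact: (integrableB _ jg jf).
  have x1 : x <= 1 by rewrite (le_trans _ xd)// lerDl ltW.
  have xd0 : 0 <= x + d by rewrite addr_ge0// ltW.
  rewrite -(IJ x)// -(IJ (x + d))//; apply/andP; split; apply: IB => //; try exact: Dint.
    move=> y Ay; rewrite JE; have [yx|_] := leP y x; first by rewrite r1.
    by have /andP[] := r01 x0 dgt0 xd Ay.
  move=> y Ay; rewrite JE; have [yx|/ltW xy] := leP y (x + d).
    by have /andP[] := r01 x0 dgt0 xd Ay.
  by rewrite r0.
move=> f Df.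
have := positive_linear_unique Tpl Ipl distribution_ramp Framp Df => ->.
by rewrite /I /Rintegral fineK//; apply: integrable_fin_num => //; exact: Dint.
Qed.

End Distribution.

End RepresentingMeasure.

(** * Test functions *)

Section TruncatedPowers.
Variables (R : realType) (p : R).
Hypothesis p1 : 1 < p.
Local Notation I01 := (`[0%R, 1%R]%classic : set R).
Implicit Types (x y s t d : R).

(** A remainder quadratic in the step is at most [e] times the step once the step is below [e / C],
    which is [sewing] with [g = 1]. *)
Lemma taylor_primitive (F k : R -> R) (C : R) : 0 < C -> {within I01, continuous k} ->
  (forall s t, 0 <= s -> s <= t -> t <= 1 ->
     `|F t - F s - k s * (t - s)| <= C * (t - s) ^+ 2) -> primitive F k.
Proof.
move=> C0 ck H.
have e1 : (fun x => k x * 1) = k by apply/funext => x; rewrite mulr1.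
split; first exact: cont01_L1.
rewrite -e1; apply: (sewing (L1_cst 1) ck) => e e0.
exists (e / C); first by rewrite divr_gt0.
move=> s t s0 st t1 ts.
have -> : itg (fun x => `|1|) s t = t - s by under [X in itg X]eq_fun do rewrite normr1; rewrite itg_cst// mul1r.
rewrite itg_cst// mul1r (le_trans (H s t s0 st t1))//.
rewrite expr2 mulrA ler_wpM2r ?subr_ge0// mulrC -ler_pdivlMr//.
exact: ltW.
Qed.

Definition pos_part t : R := Num.max t 0.

Lemma cont01_pos_part s : {within I01, continuous (fun y => pos_part (y - s))}.
Proof.
apply: within01 => e e0; exists e => // a b _ _ ab.
apply: le_trans (ltW ab).
rewrite /pos_part /Num.max; case: ltP => h1; case: ltP => h2;
  rewrite ?subrr ?normr0// ?sub0r ?subr0 ?normrN.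
- by rewrite (ger0_norm h2) distrC ger0_norm; lra.
- by rewrite (ger0_norm h1) ger0_norm; lra.
- by rewrite opprB addrA subrK.
Qed.

Definition truncated_cube s y : R := pos_part (y - s) ^+ 3.

Lemma truncated_cube_W2p s : 0 <= s <= 1 -> exists v1 v2, W2p_rep p (truncated_cube s) v1 v2.
Proof.
move=> /andP[s0 s1].
have c1 := @cont01_pos_part s.
have c2 : {within I01, continuous (fun y => 3 * pos_part (y - s) ^+ 2)}.
  by apply: (@cont01_comp _ _ (fun z => 3 * z ^+ 2)) => // z; apply: cvgM; [exact: cvg_cst|exact: exprn_continuous].
have c3 : {within I01, continuous (fun y => 6 * pos_part (y - s))}.
  by apply: (@cont01_comp _ _ (fun z => 6 * z)) => // z; apply: cvgM; [exact: cvg_cst|exact: cvg_id].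
exists (fun y => 3 * pos_part (y - s) ^+ 2), (fun y => 6 * pos_part (y - s)).
apply/W2p_repP => //; split.
- have L1p : Lp p (fun=> 1).
    by split; [exact: measurable_cst|exact: L1_cst].
  by have := LpM p1 c3 L1p; under eq_fun do rewrite mulr1.
(* In this and the next Taylor estimate, [3] is half of [6], a Lipschitz constant on [[0, 1]] of the
   derivative in question. *)
- apply: (@taylor_primitive _ _ 3) => // a b a0 ab b1.
  rewrite /pos_part /Num.max; case: ltP => h1; case: ltP => h2.
  + by rewrite expr0n/= !mulr0 mul0r !subr0 normr0 mulr_ge0// sqr_ge0.
  + lra.
  + rewrite expr0n/= !mulr0 mul0r !subr0 ger0_norm ?mulr_ge0 ?sqr_ge0//; nra.
  + rewrite ger0_norm; nra.
- apply: (@taylor_primitive _ _ 3) => // a b a0 ab b1.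
  rewrite /truncated_cube /pos_part /Num.max; case: ltP => h1; case: ltP => h2.
  + by rewrite !expr0n/= !mulr0 mul0r !subr0 normr0 mulr_ge0// sqr_ge0.
  + lra.
  + rewrite !expr0n/= !mulr0 mul0r !subr0.
    have h : 0 <= b - s <= b - a by lra.
    have h' : b - a <= 1 by lra.
    rewrite ger0_norm; last by rewrite exprn_ge0; lra.
    apply: (@le_trans _ _ ((b - s) ^+ 2)).
      by rewrite exprS ler_piMl ?sqr_ge0//; lra.
    by move: h h'; move: (b - s) (b - a) => z w; clear; nra.
  + have -> : (b - s) ^+ 3 - (a - s) ^+ 3 - 3 * (a - s) ^+ 2 * (b - a) =
      (b - a) ^+ 2 * (b - s + 2 * (a - s)) by ring.
    rewrite mulrC ger0_norm; last by rewrite mulr_ge0 ?sqr_ge0//; lra.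
    by rewrite ler_wpM2r ?sqr_ge0//; lra.
Qed.

(** The primitive of the quadratic B-spline with knots [0, 1, 2, 3]: a C^2 step from [0] to [1]. *)
Definition spline t : R :=
  (pos_part t ^+ 3 - 3 * pos_part (t - 1) ^+ 3 + 3 * pos_part (t - 2) ^+ 3 - pos_part (t - 3) ^+ 3) / 6.

Lemma spline0 t : t <= 0 -> spline t = 0.
Proof.
by move=> t0; rewrite /spline /pos_part !max_r; lra.
Qed.

Lemma spline1 t : 3 <= t -> spline t = 1.
Proof. by move=> t3; rewrite /spline /pos_part !max_l; try lra; field. Qed.

Lemma spline01 t : 0 <= spline t <= 1.
Proof.
have [t0|t0] := leP t 0; first by rewrite spline0// lexx ler01.
have [t3|t3] := leP 3 t; first by rewrite spline1// lexx ler01.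
rewrite /spline /pos_part (max_l (ltW t0)) (max_r (_ : t - 3 <= 0)); last by lra.
have [t1|t1] := leP t 1.
  by rewrite !max_r; [apply/andP; split; nra|lra|lra].
have [t2|t2] := leP t 2.
  rewrite max_l; last by lra.
  rewrite max_r; last by lra.
  have u0 : 0 <= t - 1 by lra.
  have u1 : 0 <= 2 - t by lra.
  (* Products of the distances to the ends of the cell, as in the Bernstein basis; both bounds are
     linear consequences of their signs. *)
  have h1 := mulr_ge0 (mulr_ge0 u0 u0) u0.
  have h2 := mulr_ge0 (mulr_ge0 u0 u0) u1.
  have h3 := mulr_ge0 u1 u1.
  have h4 := mulr_ge0 u0 u0.
  have h5 := mulr_ge0 (mulr_ge0 u1 u1) u0.
  rewrite !exprS !expr0; apply/andP; split; lra.
rewrite max_l; last by lra.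
rewrite max_l; last by lra.
have u0 : 0 <= 3 - t by lra.
have u1 : 0 <= t - 2 by lra.
have h1 := mulr_ge0 (mulr_ge0 u0 u0) u0.
have h2 := mulr_ge0 (mulr_ge0 u0 u0) u1.
have h3 := mulr_ge0 u0 u1.
rewrite !exprS !expr0; apply/andP; split; lra.
Qed.

End TruncatedPowers.

(** * Ramps as test functions vanishing at both ends *)

Section Ramps.
Variables (R : realType) (p : R).
Hypothesis p1 : 1 < p.
Local Notation I01 := (`[0%R, 1%R]%classic : set R).
Implicit Types (x y s t d : R).

Lemma W2p_rep_lin (c : R) f f1 f2 g g1 g2 : W2p_rep p f f1 f2 -> W2p_rep p g g1 g2 ->
  W2p_rep p (fun x => c * f x + g x) (fun x => c * f1 x + g1 x) (fun x => c * f2 x + g2 x).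
Proof.
move=> /(W2p_repP p1)[L2 pf1 pf] /(W2p_repP p1)[M2 pg1 pg]; apply/(W2p_repP p1).
split; [exact: (LpD p1 (LpZ p1 c L2) M2)|exact: primitiveD (primitiveZ c pf1) pg1|].
exact: primitiveD (primitiveZ c pf) pg.
Qed.

Lemma W2p_lin (c : R) f g : W2p p f -> W2p p g -> W2p p (fun x => c * f x + g x).
Proof.
move=> [f1 [f2 rf]] [g1 [g2 rg]].
by eexists; eexists; exact: W2p_rep_lin rf rg.
Qed.

Lemma W2pZ (c : R) f : W2p p f -> W2p p (fun x => c * f x).
Proof.
move=> Wf; have := W2p_lin (c - 1) Wf Wf.
by under eq_fun do rewrite -[X in _ + X]mul1r -mulrDl subrK.
Qed.

Lemma W2p_cont f : W2p p f -> {within I01, continuous f}.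
Proof. by move=> [f1 [f2 /(W2p_repP p1)[_ _ pf]]]; exact: primitive_cont pf. Qed.

Lemma pos_partM (c t : R) : 0 <= c -> pos_part (c * t) = c * pos_part t.
Proof. by move=> c0; rewrite /pos_part maxr_pMr// mulr0. Qed.

Definition smooth_step x d y : R := spline (3 / d * (y - x)).

Lemma smooth_step_W2p x d : 0 <= x -> 0 < d -> x + d <= 1 -> W2p p (smooth_step x d).
Proof.
move=> x0 d0 xd.
have W s : 0 <= s <= 1 -> W2p p (truncated_cube s) by move=> s01; exact: truncated_cube_W2p.
have W0 := W x; have W1 := W (x + d / 3); have W2 := W (x + 2 * d / 3); have W3 := W (x + d).
have {}W0 : W2p p (truncated_cube x) by apply: W0; apply/andP; split; lra.
have {}W1 : W2p p (truncated_cube (x + d / 3)) by apply: W1; apply/andP; split; lra.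
have {}W2 : W2p p (truncated_cube (x + 2 * d / 3)) by apply: W2; apply/andP; split; lra.
have {}W3 : W2p p (truncated_cube (x + d)) by apply: W3; apply/andP; split; lra.
have := W2pZ ((3 / d) ^+ 3 / 6) (W2p_lin (-1) W3 (W2p_lin 3 W2 (W2p_lin (-3) W1 W0))).
suff -> : smooth_step x d = (fun y => (3 / d) ^+ 3 / 6 * (-1 * truncated_cube (x + d) y +
  (3 * truncated_cube (x + 2 * d / 3) y + (-3 * truncated_cube (x + d / 3) y + truncated_cube x y)))) by [].
apply/funext => y; rewrite /smooth_step /spline /truncated_cube.
have k0 : 0 <= 3 / d by rewrite divr_ge0// ltW.
have dn0 : d != 0 by rewrite gt_eqF.
rewrite (_ : 3 / d * (y - x) - 1 = 3 / d * (y - (x + d / 3))); last by field.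
rewrite (_ : 3 / d * (y - x) - 2 = 3 / d * (y - (x + 2 * d / 3))); last by field.
rewrite (_ : 3 / d * (y - x) - 3 = 3 / d * (y - (x + d))); last by field.
by rewrite !pos_partM// !exprMn; field.
Qed.

Lemma smooth_step0 x d y : 0 < d -> y <= x -> smooth_step x d y = 0.
Proof.
by move=> d0 yx; apply: spline0; rewrite pmulr_rle0 ?divr_gt0// subr_le0.
Qed.

Lemma smooth_step1 x d y : 0 < d -> x + d <= y -> smooth_step x d y = 1.
Proof.
move=> d0 xy; apply: spline1; rewrite mulrAC ler_pdivlMr// ler_pM2l//.
by rewrite lerBrDl.
Qed.

(** The rise on [[0, e]] takes place to the left of the coincidence set and secures the value [0] at
    [0]. Beyond [e] only the descent across [[x, x + d]] is visible. *)
Definition ramp e x d y : R := smooth_step 0 e y - smooth_step x d y.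

Lemma ramp_W2p_W1p0 e x d : 0 < e -> e <= 1 -> 0 <= x -> 0 < d -> x + d <= 1 ->
  W2p_W1p0 p (ramp e x d).
Proof.
move=> e0 e1 x0 d0 xd; split; last first.
  split; rewrite /ramp; first by rewrite (smooth_step0 e0 (lexx 0)) (smooth_step0 d0 x0) subrr.
  by rewrite (smooth_step1 d0 xd) (smooth_step1 e0) ?add0r// subrr.
have h1 : W2p p (smooth_step 0 e) by apply: smooth_step_W2p; rewrite ?add0r.
have := W2p_lin (-1) (smooth_step_W2p x0 d0 xd) h1.
by under eq_fun do rewrite mulN1r addrC.
Qed.

End Ramps.

(** * Criticality of minimisers *)

Section Criticality.
Variables (R : realType) (p : R) (G psi : R -> R).
Hypothesis p1 : 1 < p.
Hypothesis dG' : forall x, derivable (derive1 G) x 1.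
Hypothesis cG' : continuous (derive1 G).
Hypothesis cG'' : continuous (derive1 (derive1 G)).
Hypothesis G'0 : forall x, 0 < derive1 G x.
Local Notation I01 := (`[0%R, 1%R]%classic : set R).
Hypothesis cpsi : {within I01, continuous psi}.
Hypothesis psi0 : psi 0 < 0.
Hypothesis psi1 : psi 1 < 0.
Variables u u1 u2 : R -> R.
Hypothesis adm : admissible p psi u u1 u2.
Hypothesis min : forall v v1 v2, admissible p psi v v1 v2 ->
  energy_p p (density G u1 u2) <= energy_p p (density G v1 v2).

Let ru : W2p_rep p u u1 u2. Proof. by case: adm. Qed.
Let Lu2 : Lp p u2. Proof. by have [] := (W2p_repP p1 _ _ _).1 ru. Qed.
Let cu1 : {within I01, continuous u1}.
Proof. by have [_ h _] := (W2p_repP p1 _ _ _).1 ru; exact: primitive_cont h. Qed.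
Let cu : {within I01, continuous u}.
Proof. by have [_ _ h] := (W2p_repP p1 _ _ _).1 ru; exact: primitive_cont h. Qed.

Let gap x := u x - psi x.

Let cgap : {within I01, continuous gap}.
Proof. by move=> x; apply: cvgB; [exact: cu|exact: cpsi]. Qed.

Let gap_ge0 x : 0 <= x <= 1 -> 0 <= gap x.
Proof. by move=> x01; rewrite subr_ge0; case: adm => _ _ _; exact. Qed.

Definition coincidence : set R := [set x : R | x \in `[0%R, 1%R] /\ u x = psi x].

Local Notation A := coincidence.

Let A01 x : A x -> 0 <= x <= 1. Proof. by move=> [+ _]; rewrite in_itv. Qed.

Lemma coincidence_closed : closed A.
Proof.
rewrite -[A]setCK; apply: open_closedC; rewrite openE => x nAx.
have [x01|nx01] := boolP (0 <= x <= 1); last first.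
  have : open (~` I01) by apply: closed_openC; exact: interval_closed.
  move=> /(_ x); rewrite /= in_itv/= => /(_ (negP nx01))[d /= d0 dI].
  by exists d => // y /dI yI [].
have g0 : 0 < gap x.
  rewrite lt_neqAle gap_ge0// andbT eq_sym subr_eq0; apply/negP => /eqP e.
  by apply: nAx; split => //; rewrite in_itv.
have [d d0 dP] := heine cgap (divr_gt0 g0 (ltr0n _ 2)).
exists d => //= y xy [y01 e].
have := dP x y x01 (A01 (conj y01 e)) xy.
rewrite {2}/gap e subrr subr0 (gtr0_norm g0); lra.
Qed.

(** At both ends [u = 0 > psi], so the continuous gap stays positive nearby. *)
Lemma coincidence_interior : exists2 d : R, 0 < d <= 1 / 2 & forall x, A x -> d <= x <= 1 - d.
Proof.
have [_ u00 u10 _] := adm.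
have g0 : 0 < gap 0 by rewrite /gap u00 sub0r oppr_gt0.
have g1 : 0 < gap 1 by rewrite /gap u10 sub0r oppr_gt0.
have [d d0 dP] := heine cgap (divr_gt0 g0 (ltr0n _ 2)).
have [e e0 eP] := heine cgap (divr_gt0 g1 (ltr0n _ 2)).
exists (Num.min (Num.min d e) (1 / 2)).
  by rewrite !lt_min d0 e0 ge_min lexx orbT; lra.
move=> x Ax; have x01 := A01 Ax; have [x0 x1] := andP x01.
have gx : gap x = 0 by rewrite /gap Ax.2 subrr.
apply/andP; split.
  rewrite !ge_min; apply/orP; left; apply/orP; left; rewrite leNgt; apply/negP => xd.
  have := dP 0 x _ x01; rewrite lexx ler01 sub0r normrN (ger0_norm x0) => /(_ isT xd).
  by rewrite gx subr0 gtr0_norm//; lra.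
rewrite lerBrDl -lerBrDr !ge_min; apply/orP; left; apply/orP; right.
rewrite leNgt; apply/negP => xe.
have := eP 1 x _ x01; rewrite ler01 lexx ger0_norm ?subr_ge0// => /(_ isT xe).
by rewrite gx subr0 gtr0_norm//; lra.
Qed.

(** The maximum of the gap and [f] is positive on [[0, 1]], hence at least some [m > 0]. Where [f]
    is negative the gap is at least [m], so [u + t f] remains above the obstacle for
    [t <= m / B]. *)
Lemma variation_ge0_of_gt0 f f1 f2 : W2p_rep p f f1 f2 -> f 0 = 0 -> f 1 = 0 ->
  (forall x, A x -> 0 < f x) -> 0 <= itg (energy_variation p G u1 u2 f1 f2) 0 1.
Proof.
move=> rf f00 f10 fA.
have [Lf2 pf1 pf] := (W2p_repP p1 _ _ _).1 rf.
have cf := primitive_cont pf.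
have [B B0 fB] := cont01_bounded cf.
have cm : {within I01, continuous (fun x => Num.max (gap x) (f x))}.
  by move=> x; apply: continuous_max; [exact: cgap|exact: cf].
have [c c01 cP] := EVT_min ler01 cm.
set m := Num.max (gap c) (f c) in cP.
have m0 : 0 < m.
  rewrite /m lt_max; have [|g0] := ltP 0 (gap c); first by [].
  rewrite in_itv/= in c01; apply: fA; split; first by rewrite in_itv.
  apply/eqP; rewrite -subr_eq0 -/(gap c) eq_le g0; exact: gap_ge0.
pose t0 := Num.min 1 (m / B).
have t00 : 0 < t0 by rewrite lt_min ltr01 divr_gt0.
have t01 : t0 <= 1 by rewrite ge_min lexx.
apply: (first_variation p1 dG' cG' cG'' cu1 (primitive_cont pf1) Lu2 Lf2 t00 t01).
move=> t tgt0 tt0.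
have [_ u00 u10 psiu] := adm.
have e v w : (fun x : R => v x + t * w x) = (fun x => t * w x + v x).
  by apply/funext => x; rewrite addrC.
apply: (min (v := fun x => t * f x + u x)); rewrite !e; split.
- exact: W2p_rep_lin.
- by rewrite f00 mulr0 u00 addr0.
- by rewrite f10 mulr0 u10 addr0.
- move=> x x01; have [fx|/ltW fx] := leP 0 (f x).
    by rewrite (le_trans (psiu x x01))// lerDr mulr_ge0// ltW.
  have gm : m <= gap x.
    have := cP x; rewrite in_itv => /(_ x01); rewrite le_max => /orP[//|mf].
    by have := lt_le_trans m0 (le_trans mf fx); rewrite ltxx.
  have tB : t * B <= m.
    by rewrite -ler_pdivlMr// (le_trans tt0)// ge_min lexx orbT.
  have tf : - (t * B) <= t * f x.
    rewrite -mulrN ler_pM2l//; have := fB x x01; rewrite ler_norml => /andP[] //.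
  by move: gm tB tf; rewrite /gap; lra.
Qed.

Lemma energy_variation_lin (c : R) f1 f2 g1 g2 :
  {within I01, continuous f1} -> {within I01, continuous g1} -> Lp p f2 -> Lp p g2 ->
  itg (energy_variation p G u1 u2 (fun x => c * f1 x + g1 x) (fun x => c * f2 x + g2 x)) 0 1 =
  c * itg (energy_variation p G u1 u2 f1 f2) 0 1 + itg (energy_variation p G u1 u2 g1 g2) 0 1.
Proof.
move=> cf cg Lf Lg.
have Vf := energy_variation_L1 p1 dG' cG' cG'' cu1 cf Lu2 Lf.
have Vg := energy_variation_L1 p1 dG' cG' cG'' cu1 cg Lu2 Lg.
rewrite -itgZ// -itgDf//; last exact: L1Z.
by apply: itg_ext => x _; rewrite /energy_variation; ring.
Qed.

(** Adding [c] times a ramp equal to [1] on [A] makes [f] positive there; then [c] tends to [0]. *)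
Lemma variation_ge0 f f1 f2 : W2p_rep p f f1 f2 -> f 0 = 0 -> f 1 = 0 ->
  (forall x, A x -> 0 <= f x) -> 0 <= itg (energy_variation p G u1 u2 f1 f2) 0 1.
Proof.
move=> rf f00 f10 fA.
have [d /andP[d0 d2] dP] := coincidence_interior.
have [[h1 [h2 rh]] [h00 h10]] : W2p_W1p0 p (ramp d (1 - d) d).
  by apply: ramp_W2p_W1p0 => //; rewrite ?subrK//; lra.
have hA x : A x -> ramp d (1 - d) d x = 1.
  move=> /dP /andP[dx xd].
  by rewrite /ramp smooth_step1 ?add0r// smooth_step0// subr0.
have [Lf2 pf1 _] := (W2p_repP p1 _ _ _).1 rf.
have [Lh2 ph1 _] := (W2p_repP p1 _ _ _).1 rh.
have lin c := @energy_variation_lin c h1 h2 f1 f2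
  (primitive_cont ph1) (primitive_cont pf1) Lh2 Lf2.
set V := itg _ 0 1; set Vh := itg (energy_variation p G u1 u2 h1 h2) 0 1 in lin.
apply/ler_addgt0Pr => e e0.
have k0 : 0 < `|Vh| + 1 by rewrite ltr_wpDl.
pose c := e / (`|Vh| + 1).
have c0 : 0 < c by rewrite divr_gt0.
have : 0 <= c * Vh + V.
  rewrite -lin; apply: (variation_ge0_of_gt0 (W2p_rep_lin p1 c rh rf)).
  - by rewrite h00 f00 mulr0 addr0.
  - by rewrite h10 f10 mulr0 addr0.
  - by move=> x Ax; rewrite hA// mulr1 ltr_wpDr ?fA.
move=> /le_trans; apply; rewrite addrC lerD2l.
by rewrite /c mulrAC ler_pdivrMr// ler_pM2l// (le_trans (ler_norm _))// lerDl ler01.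
Qed.

Lemma minimizer_critical : obstacle_critical p G psi u.
Proof.
exists u1, u2; split; first exact: ru.
have [d /andP[d0 d2] dP] := coincidence_interior.
(* The variation is a functional of the derivatives; fixing one pair for each [f] turns it into a
   functional [T] of [f] alone. *)
have /choice[w wP] (f : R -> R) : exists w : (R -> R) * (R -> R),
    W2p p f -> W2p_rep p f w.1 w.2.
  have [[f1 [f2 rf]]|nW] := pselect (W2p p f); first by exists (f1, f2).
  by exists (fun=> 0, fun=> 0).
pose T f := itg (energy_variation p G u1 u2 (w f).1 (w f).2) 0 1.
(* Two pairs of derivatives of [f] differ by a pair for the zero function, to which [variation_ge0]
   applies with either sign. *)
have TE f f1 f2 : W2p_rep p f f1 f2 -> f 0 = 0 -> f 1 = 0 ->
    T f = itg (energy_variation p G u1 u2 f1 f2) 0 1.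
  move=> rf f00 f10.
  have rw : W2p_rep p f (w f).1 (w f).2 by apply: wP; exists f1, f2.
  have [Lf2 pf1 _] := (W2p_repP p1 _ _ _).1 rf.
  have [Lw2 pw1 _] := (W2p_repP p1 _ _ _).1 rw.
  have h1 := variation_ge0 (W2p_rep_lin p1 (-1) rf rw).
  have h2 := variation_ge0 (W2p_rep_lin p1 (-1) rw rf).
  rewrite (@energy_variation_lin _ f1 f2 _ _ (primitive_cont pf1) (primitive_cont pw1)) // in h1.
  rewrite (@energy_variation_lin _ (w f).1 (w f).2 f1 f2 (primitive_cont pw1) (primitive_cont pf1)) // in h2.
  rewrite f00 f10 mulr0 addr0 in h1 h2.
  have z x : A x -> 0 <= -1 * f x + f x by move=> _; rewrite mulN1r addNr.
  have {}h1 := h1 erefl erefl z; have {}h2 := h2 erefl erefl z.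
  rewrite -/(T f) !mulN1r in h1 h2.
  by apply/eqP; rewrite eq_le -subr_ge0 -[X in _ && X]subr_ge0 addrC h2 addrC h1.
have Tpl : positive_linear A (W2p_W1p0 p) T.
  split=> [c f g [Wf [f00 f10]] [Wg [g00 g10]]|f [Wf [f00 f10]] fA].
    have [Lf2 pf1 _] := (W2p_repP p1 _ _ _).1 (wP f Wf).
    have [Lg2 pg1 _] := (W2p_repP p1 _ _ _).1 (wP g Wg).
    rewrite (TE _ _ _ (W2p_rep_lin p1 c (wP f Wf) (wP g Wg))).
    - exact: (energy_variation_lin c (primitive_cont pf1) (primitive_cont pg1) Lf2 Lg2).
    - by rewrite f00 g00 mulr0 addr0.
    - by rewrite f10 g10 mulr0 addr0.
  exact: variation_ge0 (wP f Wf) f00 f10 fA.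
have [mu [muT mu0 muI]] : exists mu : {measure set R -> \bar R},
    [/\ (mu setT < +oo)%E, mu (~` A) = 0%E &
     forall f, W2p_W1p0 p f -> (\int[mu]_(x in I01) (f x)%:E = (T f)%:E)%E].
  apply: (@positive_linear_representation R A d (W2p_W1p0 p) (ramp d) d0 dP coincidence_closed
    _ _ _ _ _ _ _ _ T Tpl).
  - move=> c f g [Wf [f00 f10]] [Wg [g00 g10]]; split; first exact: W2p_lin.
    by rewrite f00 g00 f10 g10 mulr0 addr0.
  - by move=> f [/(W2p_cont p1)].
  - by move=> f [_ []].
  - by move=> x t x0 t0 xt; apply: ramp_W2p_W1p0 => //; lra.
  - move=> x t y x0 t0 xt /dP /andP[dy _].
    rewrite /ramp (smooth_step1 d0) ?add0r//.
    by have /andP[] := spline01 (3 / t * (y - x)); rewrite -/(smooth_step x t y); lra.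
  - move=> x t y x0 t0 xt /dP /andP[dy _] yx.
    by rewrite /ramp (smooth_step1 d0) ?add0r// smooth_step0// subr0.
  - move=> x t y x0 t0 xt /dP /andP[dy _] yx.
    by rewrite /ramp (smooth_step1 d0) ?add0r// smooth_step1// subrr.
  - lra.
exists mu; split => //; split => // f f1 f2 rf f00 f10.
rewrite muI; last by split => //; exists f1, f2.
have [Lf2 pf1 _] := (W2p_repP p1 _ _ _).1 rf.
have V := energy_variation_L1 p1 dG' cG' cG'' cu1 (primitive_cont pf1) Lu2 Lf2.
rewrite (TE f f1 f2 rf f00 f10).
have LV : L1 (fun x => w_rep p G u1 u2 x * test_deriv G u1 u2 f1 f2 x).
  apply: L1_ext (L1Z (-1) V) => x _.
  by rewrite energy_variationE// mulN1r opprK.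
rewrite (itg_fin LV) -EFinN; congr (_%:E).
rewrite -mulN1r -itgZ//; apply: itg_ext => x _.
by rewrite energy_variationE// mulN1r.
Qed.

End Criticality.

(** * From the energy threshold to the minimiser *)

Theorem theorem4p1 (R : realType) (p : R) (G psi : R -> R)
  (hp : 1 < p)
  (hGsmooth : forall (n : nat) (x : R), derivable (derive1n n G) x 1)
  (hGodd : forall x : R, G (- x) = - G x)
  (hGpos : forall x : R, 0 < derive1 G x)
  (hGL1 : (@lebesgue_measure R).-integrable setT (fun s => (s * derive1 G s)%:E))
  (hpsi : {within `[0%R, 1%R], continuous psi})
  (hpsi0 : psi 0 < 0) (hpsi1 : psi 1 < 0)
  (hpsix0 : exists2 x0, x0 \in `]0%R, 1%R[ & 0 < psi x0)
  (hinf : (inf_energy p G psi < ((2 `^ p)^-1 * cpG G `^ p)%:E)%E) :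
  exists2 us, us \in Mpsi p psi &
    energy p G us = inf_energy p G psi /\ obstacle_critical p G psi us.
Proof.
have dG x : derivable G x 1 by have := hGsmooth 0%N x; rewrite derive1n0.
have dG' x : derivable (derive1 G) x 1 by have := hGsmooth 1%N x; rewrite derive1n1.
have dG'' x : derivable (derive1 (derive1 G)) x 1.
  by have := hGsmooth 2%N x; rewrite derive1nS derive1n1.
have cG' : continuous (derive1 G).
  by move=> x; apply/differentiable_continuous/derivable1_diffP.
have cG'' : continuous (derive1 (derive1 G)).
  by move=> x; apply/differentiable_continuous/derivable1_diffP.
have p0 : 0 < p := lt_trans ltr01 hp.
have e_ge0 u : (0 <= energy p G u)%E.
  apply: le_ereal_inf_tmp => _ [w _ <-]; apply: integral_ge0 => x _.
  by rewrite lee_fin powR_ge0.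
have inf_ge0 : (0 <= inf_energy p G psi)%E by apply: le_ereal_inf_tmp => _ [u _ <-].
have infE : inf_energy p G psi = (fine (inf_energy p G psi))%:E.
  by rewrite fineK// ge0_fin_numE// (lt_trans hinf (ltry _)).
set J := fine _ in infE.
have J0 : 0 <= J by rewrite -lee_fin -infE.
have {}hinf : J < (2 `^ p)^-1 * cpG G `^ p by rewrite -lte_fin -infE.
(* If [G] were unbounded then [lim] would be the junk value [0]. *)
have cvgG : cvg (G x @[x --> +oo]).
  apply: contrapT => /dvgP dv; move: hinf; rewrite /cpG dv.
  rewrite (_ : 2 * _ = 0); last exact: mulr0.
  by rewrite powR0 ?gt_eqF// mulr0 ltNge J0.
set L := lim (G x @[x --> +oo]) in cvgG.
have GL x : G x <= L.
  apply: limr_ge => //; exists x; split; first exact: num_real.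
  by move=> y xy; rewrite (G_incr dG hGpos) ltW.
have L0 : 0 < L.
  apply: lt_le_trans (GL 1).
  by rewrite -(G_at0 hGodd) ltNge (G_incr dG hGpos) -ltNge.
(* As [cpG G = 2 * L], the factors [2^p] cancel and the threshold is [L^p]. *)
have JL : J < np p L.
  apply: lt_le_trans hinf _; rewrite /cpG -/L powRM// ?(ltW L0)//.
  by rewrite mulKf ?gt_eqF ?powR_gt0// /np ger0_norm ?(ltW L0).
(* [np p l] is halfway between [J] and [L^p]: this leaves room for near-minimisers above [J] and
   keeps [l] strictly below the supremum of [G]. *)
pose l := ((J + np p L) / 2) `^ p^-1.
have K0 : 0 < (J + np p L) / 2 by rewrite divr_gt0// ltr_wpDl// np_gt0 ?gt_eqF.
have l0 : 0 < l by rewrite powR_gt0.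
have npl : np p l = (J + np p L) / 2.
  by rewrite /np ger0_norm ?ltW// -powRrM mulVf ?gt_eqF// powRr1// ltW.
have Jl : J < np p l by rewrite npl; lra.
have lL : l < L.
  rewrite ltNge; apply/negP => Ll.
  have : np p L <= np p l by apply: ler_np => //; rewrite (ger0_norm (ltW L0)) (ger0_norm (ltW l0)).
  by rewrite npl; lra.
(* If [G] stayed below [l] everywhere, its limit [L] would be at most [l]. *)
have [M lM] : exists M, l <= G M.
  apply: contrapT => nM; move: lL; rewrite ltNge => /negP; apply.
  apply: limr_le => //; apply: nearW => x; rewrite leNgt; apply/negP => /ltW lG.
  by apply: nM; exists x.
have near_min (e : R) : 0 < e -> exists u u1 u2, admissible p psi u u1 u2 /\
    energy_p p (fun x => derive1 G (u1 x) * u2 x) <= J + e.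
  move=> e0.
  have : (inf_energy p G psi < (J + e)%:E)%E by rewrite infE lte_fin ltrDl.
  move=> /ereal_inf_lt[_ [u [[_ [u0 u10]] upsi] <-]] /ereal_inf_lt[_ [[u1 u2] /= ru <-]].
  rewrite (energy_repE hp cG' ru) lte_fin => /ltW E; exists u, u1, u2; split => //.
have [u [u1 [u2 [adm E]]]] := minimizer_exists hp dG cG' hGpos hGodd l0 lM Jl near_min.
have inM v v1 v2 : admissible p psi v v1 v2 -> Mpsi p psi v.
  move=> [rv v0 v10 vpsi]; split; first by split => //; exists v1, v2.
  by move=> x; rewrite in_itv; exact: vpsi.
have Jle v v1 v2 : admissible p psi v v1 v2 -> J <= energy_p p (density G v1 v2).
  move=> av; have [rv _ _ _] := av.
  rewrite -lee_fin -infE -(energy_repE hp cG' rv).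
  apply: (@le_trans _ _ (energy p G v)).
    by apply: ereal_inf_lbound; exists v => //; exact: inM av.
  by apply: ereal_inf_lbound; exists (v1, v2).
exists u; first by rewrite inE; exact: inM adm.
split.
  apply/eqP; rewrite eq_le; apply/andP; split; last first.
    by apply: ereal_inf_lbound; exists u => //; exact: inM adm.
  have [ru _ _ _] := adm.
  apply: (@le_trans _ _ (energy_rep p G u1 u2)).
    by apply: ereal_inf_lbound; exists (u1, u2).
  by rewrite (energy_repE hp cG' ru) infE lee_fin.
apply: (minimizer_critical hp dG' cG' cG'' hGpos hpsi hpsi0 hpsi1 adm).
by move=> v v1 v2 av; exact: le_trans E (Jle _ _ _ av).
Qed.
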